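(* Let $T$ be a complete theory, $M$ a model, $\phi(x,y)$ a formula, and $\mu\in\mathfrak{M}_x(\mathcal U)$ a global Keisler measure such that $\mu|_M$ is dependent. Then for any $\mu|_M$-measurable subsets $X_1,\dots,X_m\subseteq S_x(M)$ and any $\epsilon>0$, there are $n\in\mathbb N$ and $E\subseteq (S_x(\mathcal U))^n$ with $(\mu^n)^*(E)\geq 1-\epsilon$ such that for every $b\in M$ and every $k\leq m$, $$\big|\mu(\phi(x,b)\cap X_k)-\mathrm{Av}(p_1|_M,\dots,p_n|_M;\phi(x,b)\cap X_k)\big|\leq\epsilon$$ for all $(p_1,\dots,p_n)\in E$.
   Context: $\mathcal U$ is the monster model of $T$. Keisler measures over $B$ in variable $x$ are identified with complete regular Borel probability measures on $S_x(B)$; global means over $\mathcal U$. For $A\subseteq B$, $\mu|_A$ is the pushforward under restriction $S_x(B)\to S_x(A)$, and $p|_M$ denotes the restriction of a type $p$ to $M$. $\mu^n$ is the $n$-fold product measure and $(\mu^n)^*$ its outer measure. For a formula $\phi(x,b)$ with $b\in M$, $\phi(x,b)$ also denotes the clopen set $\{p\in S_x(M):\phi(x,b)\in p\}$, and $\mu(\phi(x,b)\cap X_k)$ means $\mu|_M$ of that intersection. For $q_1,\dots,q_n\in S_x(M)$ and $Y\subseteq S_x(M)$, $\mathrm{Av}(q_1,\dots,q_n;Y)=|\{i\le n: q_i\in Y\}|/n$. Dependence of a measure $\nu$ over $M$: for $A\subseteq B\subseteq M$ and a formula $\phi(x,y)$, let $S_\phi(B)$ be the space of complete $\phi$-types over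 $B$, $\phi(p,b)\in\{0,1\}$ the truth value of $\phi(x,b)\in p$, and $\nu_{\phi,B}$ the pushforward of $\nu|_B$ to $S_\phi(B)$. $\nu$ is dependent over $B$ and in $A$ if for every $\phi(x,y)$ there is no measurable $E\subseteq S_\phi(B)$ with $\nu_{\phi,B}(E)>0$ such that for all $k\ge1$, $\nu_{\phi,B}^k(D_k)=(\nu_{\phi,B}(E))^k$, where $D_k=\{(p_1,\dots,p_k)\in E^k:\forall I\subseteq\{1,\dots,k\}\ \exists b\in A\ (\phi(p_i,b)=0 \text{ for } i\in I,\ \phi(p_i,b)=1 \text{ for } i\notin I)\}$. $\nu$ is dependent if this holds for all $A\subseteq B\subseteq M$. *)

(* Defs.v *)
From HB Require Import structures.
From mathcomp Require Import all_boot all_order all_algebra.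
From mathcomp Require Import all_classical all_reals all_analysis.
From mathcomp Require Import measurable_realfun.

Set Implicit Arguments.
Unset Strict Implicit.
Unset Printing Implicit Defensive.

Import Order.TTheory GRing.Theory Num.Theory.

Local Open Scope classical_set_scope.
Local Open Scope ring_scope.

Record language := Language {
  fsym : Type;
  farity : fsym -> nat;
  rsym : Type;
  rarity : rsym -> nat }.

(* [term L n] and [formula L n]: the free variables are among the n variables
   'I_n; the variable bound by [Forall] is [ord0], the variable [i] of the
   context becoming [lift ord0 i] under the quantifier. *)
Inductive term (L : language) (n : nat) : Type :=
| Var of 'I_n
| App (f : fsym L) of ('I_(farity f) -> term L n).

Inductive formula (L : language) : nat -> Type :=
| Falsum n : formula L n
| Equal n : term L n -> term L n -> formula L n
| Rel n (r : rsym L) : ('I_(rarity r) -> term L n) -> formula L n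
| Imp n : formula L n -> formula L n -> formula L n
| Forall n : formula L n.+1 -> formula L n.

Definition Neg L n (f : formula L n) : formula L n := Imp f (Falsum L n).

Record structure (L : language) := Structure {
  carrier :> Type;
  carrier_inhabited : inhabited carrier;
  fint : forall f : fsym L, ('I_(farity f) -> carrier) -> carrier;
  rint : forall r : rsym L, ('I_(rarity r) -> carrier) -> Prop }.
Arguments fint {L} N f _ : rename.
Arguments rint {L} N r _ : rename.

Fixpoint teval L (N : structure L) n (v : 'I_n -> N) (t : term L n) : N :=
  match t with
  | Var i => v i
  | App f args => fint N f (fun j => teval v (args j))
  end.

Definition scons (T : Type) n (d : T) (v : 'I_n -> T) : 'I_n.+1 -> T :=
  fun i => oapp v d (unlift ord0 i).

Definition fcat (T : Type) n m (v : 'I_n -> T) (w : 'I_m -> T) :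
  'I_(n + m) -> T :=
  fun i => match fintype.split i with inl j => v j | inr j => w j end.

Fixpoint sat L (N : structure L) n (f : formula L n) : ('I_n -> N) -> Prop :=
  match f in formula _ n return ('I_n -> N) -> Prop with
  | Falsum _ => fun _ => False
  | Equal _ s t => fun v => teval v s = teval v t
  | Rel _ r args => fun v => rint N r (fun j => teval v (args j))
  | Imp _ f1 f2 => fun v => sat f1 v -> sat f2 v
  | Forall _ f1 => fun v => forall d : N, sat f1 (scons d v)
  end.

Definition theory (L : language) := set (formula L 0).

Definition models L (N : structure L) (T : theory L) : Prop :=
  forall s, T s -> forall v : 'I_0 -> N, sat s v.

Definition complete_theory L (T : theory L) : Prop :=
  (exists N : structure L, models N T) /\
  forall s : formula L 0,
    (forall N : structure L, models N T -> models N [set s]) \/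
    (forall N : structure L, models N T -> models N [set Neg s]).

Definition elementary_embedding L (N U : structure L) (h : N -> U) : Prop :=
  forall n (f : formula L n) (v : 'I_n -> N), sat f v <-> sat f (h \o v).

(* M is the universe of an elementary substructure of [U]. *)
Definition elementary_submodel L (U : structure L) (M : set U) : Prop :=
  exists (N : structure L) (h : N -> U),
    elementary_embedding h /\ range h = M.

Definition is_automorphism L (U : structure L) (g : U -> U) : Prop :=
  [/\ bijective g,
      forall (f : fsym L) v, g (fint U f v) = fint U f (g \o v) &
      forall (r : rsym L) v, rint U r v <-> rint U r (g \o v)].

Definition elementary_on L (U : structure L) (A : set U) (f : U -> U) : Prop :=
  forall n (phi : formula L n) (v : 'I_n -> U), (forall i, A (v i)) ->
    sat phi v <-> sat phi (f \o v).

(* [PFml phi b] is the formula phi(x, b) in the p-tuple of variables x, with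
   parameters b. *)
Record pformula L (U : structure L) (p : nat) := PFml {
  parity : nat;
  pfml : formula L (p + parity);
  pprm : 'I_parity -> U }.
Arguments pprm {L U p} _ _.

Definition psat L (U : structure L) p (psi : pformula U p) (a : 'I_p -> U) :=
  sat (pfml psi) (fcat a (pprm psi)).

Definition pneg L (U : structure L) p (psi : pformula U p) : pformula U p :=
  PFml (Neg (pfml psi)) (pprm psi).

Definition finsat L (U : structure L) p (P : set (pformula U p)) : Prop :=
  forall F, finite_set F -> F `<=` P ->
    exists a : 'I_p -> U, forall psi, F psi -> psat psi a.

(* Sets of formulas with parameters closed under negation up to equivalence;
   complete types over B and complete phi-types over B are the types relative
   to the fragments [fml_over] and [phi_instances] below. *)
Record fragment L (U : structure L) p := Fragment {
  fragment_set :> set (pformula U p);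
  fragment_neg : forall psi, fragment_set psi ->
    exists2 psi', fragment_set psi' & forall a, psat psi' a <-> ~ psat psi a }.

Definition is_type L (U : structure L) p (D : fragment U p)
    (P : set (pformula U p)) : Prop :=
  [/\ P `<=` D, finsat P &
      forall Q, P `<=` Q -> Q `<=` D -> finsat Q -> Q = P].

Definition tspace L (U : structure L) p (D : fragment U p) : Type :=
  {P : set (pformula U p) | is_type D P}.

Definition in_type L (U : structure L) p (D : fragment U p)
    (psi : pformula U p) (P : tspace D) : Prop := sval P psi.

Definition clopen_of L (U : structure L) p (D : fragment U p)
    (psi : pformula U p) : set (tspace D) := [set P | in_type psi P].
Arguments clopen_of {L U p} D psi.

Section fragments.
Context L (U : structure L) (p : nat).

Lemma psat_neg (psi : pformula U p) a : psat (pneg psi) a <-> ~ psat psi a.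
Proof. by []. Qed.

Lemma fml_over_neg (B : set U) (psi : pformula U p) :
  (forall i, B (pprm psi i)) ->
  exists2 psi' : pformula U p, (forall i, B (pprm psi' i)) &
    forall a, psat psi' a <-> ~ psat psi a.
Proof. by move=> Bpsi; exists (pneg psi). Qed.

Definition fml_over (B : set U) : fragment U p :=
  Fragment (fragment_set := [set psi | forall i, B (pprm psi i)])
    (@fml_over_neg B).

Lemma phi_instances_neg (B : set U) q (phi : formula L (p + q))
    (psi : pformula U p) :
  (exists2 b : 'I_q -> U, (forall i, B (b i)) &
    psi = PFml phi b \/ psi = pneg (PFml phi b)) ->
  exists2 psi' : pformula U p,
    (exists2 b : 'I_q -> U, (forall i, B (b i)) &
      psi' = PFml phi b \/ psi' = pneg (PFml phi b)) &
    forall a, psat psi' a <-> ~ psat psi a.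
Proof.
move=> [b Bb [->|->]].
  by exists (pneg (PFml phi b)) => //; exists b => //; right.
exists (PFml phi b); first by exists b => //; left.
by move=> a; rewrite psat_neg notK.
Qed.

Definition phi_instances (B : set U) q (phi : formula L (p + q)) :
    fragment U p :=
  Fragment (fragment_set := [set psi | exists2 b : 'I_q -> U,
      (forall i, B (b i)) & psi = PFml phi b \/ psi = pneg (PFml phi b)])
    (@phi_instances_neg B q phi).

Lemma fml_over_sub (A B : set U) : A `<=` B -> fml_over A `<=` fml_over B.
Proof. by move=> AB psi Apsi i; apply: AB; apply: Apsi. Qed.

Lemma phi_instances_sub (B : set U) q (phi : formula L (p + q)) :
  phi_instances B phi `<=` fml_over B.
Proof. by move=> _ [b Bb [->|->]] i; apply: Bb. Qed.

Definition tp (D : fragment U p) (a : 'I_p -> U) : set (pformula U p) :=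
  [set psi | fragment_set D psi /\ psat psi a].

Lemma is_type_tp (D : fragment U p) a : is_type D (tp D a).
Proof.
split; first by move=> psi [].
  by move=> F _ FP; exists a => psi /FP[].
move=> Q PQ QD Qsat; apply/seteqP; split => // psi Qpsi.
split; first exact: QD.
apply: contrapT => npsi.
have [psi' Dpsi' psi'E] := fragment_neg (QD _ Qpsi).
have [|x [->|->]//|a' a'P] := Qsat [set psi; psi'].
- exact: finite_set2.
- by apply: PQ; split => //; apply/psi'E.
- have /psi'E := a'P psi' (or_intror erefl); apply.
  exact: (a'P psi (or_introl erefl)).
Qed.

Lemma tspace_inhabited (D : fragment U p) : exists _ : tspace D, True.
Proof.
have [d] := carrier_inhabited U.
by exists (exist _ _ (is_type_tp D (fun=> d))).
Qed.

Lemma is_type_restrict (D D' : fragment U p) (P : set (pformula U p)) :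
  D' `<=` D -> is_type D P -> is_type D' (P `&` D').
Proof.
move=> D'D [PD Psat Pmax]; split => //.
  by move=> F Ffin FP; apply: Psat => // psi /FP[].
move=> Q PQ QD Qsat; apply/seteqP; split => // psi Qpsi.
split; last exact: QD.
apply: contrapT => nPpsi.
have [psi' Dpsi' psi'E] := fragment_neg (QD _ Qpsi).
suff Ppsi' : P psi'.
  have [|x [->|->]//|a' a'P] := Qsat [set psi; psi'].
  - exact: finite_set2.
  - by apply: PQ.
  - have /psi'E := a'P psi' (or_intror erefl); apply.
    exact: (a'P psi (or_introl erefl)).
have refute chi : fragment_set D chi -> ~ P chi -> exists F : set (pformula U p),
    [/\ finite_set F, F `<=` P &
        forall a, (forall xi, F xi -> psat xi a) -> ~ psat chi a].
  move=> Dchi nPchi; apply: contrapT => nF; apply: nPchi.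
  suff <- : P `|` [set chi] = P by right.
  apply: Pmax; [by left|by move=> xi [/PD//|->]|].
  move=> F Ffin FP; apply: contrapT => nsat; apply: nF.
  exists (F `&` P); split; [exact: finite_setIl|by move=> ? []|].
  move=> a aF chia; apply: nsat; exists a => xi Fxi.
  by case: (FP _ Fxi) => [Pxi|->//]; apply: aF.
apply: contrapT => nPpsi'.
have [F [Ffin FP Fpsi]] := refute _ (D'D _ (QD _ Qpsi)) nPpsi.
have [F' [F'fin F'P F'psi']] := refute _ (D'D _ Dpsi') nPpsi'.
have [||a aFF'] := Psat (F `|` F').
- by rewrite finite_setU.
- by move=> xi [/FP|/F'P].
- apply: (F'psi' a) => [xi F'xi|]; first by apply: aFF'; right.
  by apply/psi'E; apply: Fpsi => xi Fxi; apply: aFF'; left.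
Qed.

End fragments.
Arguments fml_over {L U} p B.
Arguments fml_over_sub {L U} p {A B}.
Arguments phi_instances_sub {L U p} B {q} phi.

HB.instance Definition _ L (U : structure L) p (D : fragment U p) :=
  gen_eqMixin (tspace D).
HB.instance Definition _ L (U : structure L) p (D : fragment U p) :=
  gen_choiceMixin (tspace D).
HB.instance Definition _ L (U : structure L) p (D : fragment U p) :=
  isPointed.Build (tspace D) (projT1 (cid (tspace_inhabited D))).
HB.instance Definition _ L (U : structure L) p (D : fragment U p) :=
  isSubBaseTopological.Build (tspace D)
    [set clopen_of D psi | psi in (D : set _)] id.

(* S_x(B) and S_phi(B) *)
Notation stype p B := (tspace (fml_over p B)).
Notation sphi B phi := (tspace (phi_instances B phi)).

Notation borel T := (g_sigma_algebraType (@open T)).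

Section restriction.
Context L (U : structure L) (p : nat) (D D' : fragment U p).
Hypothesis sD : D' `<=` D.

Definition trestrict (P : tspace D) : tspace D' :=
  exist _ (sval P `&` D') (is_type_restrict sD (svalP P)).

Lemma open_clopen_of (E : fragment U p) psi :
  fragment_set E psi -> open (clopen_of E psi).
Proof.
move=> Epsi; exists [set clopen_of E psi]; last by rewrite bigcup_set1.
by move=> _ ->; apply: (finI_from1 id); exists psi.
Qed.

Lemma continuous_trestrict : continuous trestrict.
Proof.
apply/continuousP => _ [C sC <-]; rewrite preimage_bigcup.
apply: bigcup_open => _ /sC [F sF <-].
rewrite preimage_bigcap bigcap_fset big_seq; apply: big_ind => //.
- exact: openT.
- exact: openI.
move=> A /sF; rewrite inE => -[psi D'psi <-].
rewrite (_ : _ @^-1` _ = clopen_of D psi).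
  exact/open_clopen_of/sD.
by apply/seteqP; split => P /=; rewrite /clopen_of /in_type /=; [case|].
Qed.

Definition brestrict : borel (tspace D) -> borel (tspace D') := trestrict.

Lemma measurable_brestrict : measurable_fun setT brestrict.
Proof.
apply: (@measurability _ _ (borel (tspace D)) (borel (tspace D')) setT
  brestrict (@open (tspace D')) erefl).
move=> _ [A oA <-]; rewrite setTI; apply: sub_sigma_algebra.
by move/continuousP : continuous_trestrict; apply.
Qed.

HB.instance Definition _ :=
  isMeasurableFun.Build _ _ _ _ brestrict measurable_brestrict.

Definition measure_restrict (R : realType) (nu : probability (borel (tspace D)) R) :
    probability (borel (tspace D')) R :=
  distribution nu brestrict.

End restriction.

(* For a set X, [completed_algebra_gen mu X] says that X is measurable for the
   completion of mu, and then [mu^* X] is its measure for this completion. *)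

Section power.
Context d (T : measurableType d) (R : realType) (P : probability T R).

Definition tuple_cons n (x : T * n.-tuple T) : n.+1.-tuple T :=
  [tuple of x.1 :: x.2].

Lemma measurable_tuple_cons n : measurable_fun setT (@tuple_cons n).
Proof. by apply: measurable_cons. Qed.

HB.instance Definition _ n :=
  isMeasurableFun.Build _ _ _ _ (@tuple_cons n) (@measurable_tuple_cons n).

(* the n-fold product of P, on the n-fold product sigma-algebra *)
Fixpoint power_prob n : probability (n.-tuple T) R :=
  match n with
  | 0 => \d_([tuple] : 0.-tuple T)
  | n'.+1 => distribution (P \x power_prob n')%E (@tuple_cons n')
  end.

Lemma power_prob_box n (A : 'I_n -> set T) : (forall i, measurable (A i)) ->
  power_prob n [set t | forall i, A i (tnth t i)] = (\prod_(i < n) P (A i))%E.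
Proof.
elim: n A => [|n IHn] A mA.
  by rewrite big_ord0 /= diracE mem_set// => -[].
rewrite big_ord_recl /= /distribution /pushforward -IHn//.
rewrite -product_measure1E//; last first.
  rewrite (_ : [set _ | _] =
      \big[setI/setT]_(i < n) ((@tnth n T)^~ i @^-1` A (lift ord0 i))).
    apply: big_ind => //; [exact: measurableI|move=> i _].
    by rewrite -[X in measurable X]setTI; exact: measurable_tnth.
  rewrite -bigcap_seq; apply/seteqP; split => t /= At i; first by move=> _; apply: At.
  by apply: At; rewrite /= mem_index_enum.
congr product_measure1.
apply/seteqP; split => -[x t] /=.
  move=> At; split; first exact: (At ord0).
  by move=> i; have := At (lift ord0 i); rewrite tnthS.
move=> [Ax At] i; case: (unliftP ord0 i) => [j ->|->]; last exact: Ax.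
by rewrite tnthS; exact: At.
Qed.

End power.

Definition regular_measure (T : ptopologicalType) (R : realType)
    (mu : set (borel T) -> \bar R) : Prop :=
  forall A : set (borel T), measurable A ->
    mu A = ereal_inf [set mu O | O in [set O : set T | open O /\ A `<=` O]] /\
    mu A = ereal_sup [set mu K | K in [set K : set T | compact K /\ K `<=` A]].

Definition Av (R : realType) (T : Type) n (t : n.-tuple T) (Y : set T) : R :=
  #|[pred i : 'I_n | `[< Y (tnth t i) >]]|%:R / n%:R.

Local Open Scope measure_scope.
Local Open Scope card_scope.

Section dependent.
Context L (U : structure L) (p : nat) (R : realType).

(* the set D_k: the k-tuples in E all of whose subsets are cut out by instances
   of phi with parameters in A *)
Definition shattered (A B : set U) q (phi : formula L (p + q))
    (E : set (borel (sphi B phi))) k : set (k.-tuple (borel (sphi B phi))) :=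
  [set t | (forall i, E (tnth t i)) /\
    forall I : {set 'I_k}, exists2 b : 'I_q -> U, (forall j, A (b j)) &
      forall i, in_type (PFml phi b) (tnth t i) <-> i \notin I].

(* nu is dependent over B and in A. As D_k need not belong to the product
   sigma-algebra, the equation nuphi^k(D_k) = nuphi(E)^k is read in the completed
   product measure and includes the measurability of D_k. *)
Definition dependent_over_in (M : set U)
    (nu : probability (borel (stype p M)) R) (A B : set U) (BM : B `<=` M) :=
  forall q (phi : formula L (p + q)),
  let nuB := measure_restrict (fml_over_sub p BM) nu in
  let nuphi := measure_restrict (phi_instances_sub B phi) nuB in
  ~ exists E : set (borel (sphi B phi)),
    [/\ completed_algebra_gen nuphi E, (0 < nuphi^* E)%E &
      forall k, (0 < k)%N ->
        completed_algebra_gen (power_prob nuphi k) (shattered A E (k := k)) /\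
        (power_prob nuphi k)^* (shattered A E (k := k)) = (nuphi^* E ^+ k)%E].

Definition dependent (M : set U) (nu : probability (borel (stype p M)) R) :=
  forall A B : set U, A `<=` B -> forall BM : B `<=` M,
    dependent_over_in nu A BM.

End dependent.

Definition small (kappa T : Type) (A : set T) : Prop :=
  ~ ([set: kappa] #<= A).

(* U is a kappa-saturated, strongly kappa-homogeneous model of T, where
   kappa > |T|. *)
Definition monster_model L (T : theory L) (kappa : Type) (U : structure L) :=
  [/\ models U T,
      small kappa [set: {n & formula L n}],
      forall A : set U, small kappa A -> forall n (P : stype n A),
        exists a : 'I_n -> U, forall psi, in_type psi P -> psat psi a &
      forall (A : set U) (f : U -> U), small kappa A -> elementary_on A f ->
        exists2 g, is_automorphism g & forall a, A a -> g a = f a].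

(* Main.v *)
Require Import Defs.
From HB Require Import structures.
From mathcomp Require Import all_boot all_order all_algebra.
From mathcomp Require Import all_classical all_reals all_analysis.
From mathcomp Require Import measurable_realfun.
From mathcomp Require Import ring lra zify.

(** Suppose that the frequencies of the sets phi(x,b) /\ X in i.i.d. samples do
    not converge uniformly over b. By symmetrization with a ghost sample and
    Hoeffding's bound, with probability bounded below a large sample is cut by
    these sets in exponentially many ways, so by the Sauer-Shelah lemma a fixed
    fraction gamma of its points is shattered. Pass to the limit along an
    ultrafilter on the sample size and keep the points x such that every
    phi-cell of x (for finitely many parameters) receives from the shattered
    subsample at least gamma/2 times its mass. This set has measure at least
    gamma/2, and for every k almost all of its k-tuples are shattered, which
    contradicts dependence (this is Talagrand's characterization of
    Glivenko-Cantelli classes). Hence one n serves all finite sets of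
    parameters.

    All b in M are then handled by compactness. By regularity, up to small
    measure each X_k is clopen relative to a compact set F, so in F^n the tuples
    violating the estimate for a given b form a relatively open set. Measurable
    sets of tuples being inner regular for closed sets, a measurable set of bad
    tuples of measure greater than eps/2 would contain a compact set of measure
    greater than eps/2, which is covered by finitely many b. *)

Set Implicit Arguments.
Unset Strict Implicit.
Unset Printing Implicit Defensive.

Import Order.TTheory GRing.Theory Num.Theory.

Local Open Scope ring_scope.

(** * Symmetrization over finite probability spaces *)

(** The set of tuples violating the estimate for some [b] in [M] need not be measurable, so the
    sampling estimates are made for finitely many parameters at a time. Then only finitely many
    cells matter, and expectations are sums over a finite weighted set.

    The subsample of each stage is shattered by a number of parameters that may grow with the stage.
    What survives the limit is a monotonicity: the probability that a random [k]-tuple is not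
    shattered by the first [s] parameters decreases in [s], hence converges. So, up to an error
    fixed in advance, tuples shattered by later parameters are already shattered by the first [s i].

    The samples are cut by phi(x,b) within [X], whereas dependence speaks of phi alone; but a
    subsample shattered by the smaller sets lies inside [X], so phi shatters it too. The fraction
    gamma/2 is what remains of gamma when the rejected cells take their largest possible share,
    gamma/2. *)

Section pajor.
Import boot.fintype boot.finset.
Local Open Scope set_scope.
Context (K : finType).

Definition shatters (F : {set {set K}}) (I : {set K}) : bool :=
  [forall (S : {set K} | S \subset I), [exists T in F, T :&: I == S]].

Lemma shattersP (F : {set {set K}}) (I : {set K}) :
  reflect (forall S : {set K}, S \subset I -> exists2 T, T \in F & T :&: I = S)
    (shatters F I).
Proof.
apply: (iffP forall_inP) => h S SI.
  by have /exists_inP[T TF /eqP TS] := h _ SI; exists T.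
by have [T TF TS] := h S SI; apply/exists_inP; exists T => //; rewrite TS.
Qed.

Lemma shatters_sub (F G : {set {set K}}) (I : {set K}) :
  F \subset G -> shatters F I -> shatters G I.
Proof.
move=> /subsetP FG /shattersP h; apply/shattersP => S /h[T /FG TG TS].
by exists T.
Qed.

(** Split [F] along an element [x] separating two of its members: a set
    shattered by both halves stays shattered by [F] after adding [x]. *)
Lemma pajor (F : {set {set K}}) :
  (#|F| <= #|[set I | shatters F I]|)%N.
Proof.
move: {2}#|F| (leqnn #|F|) => m; elim: m F => [|m IH] F.
  by rewrite leqn0 => /eqP ->.
case: (leqP #|F| 1) => [F1 _|/card_gt1P[T0 [T1 [T0F T1F T01]]] Fm].
  have [->|/set0Pn[T TF]] := eqVneq F set0; first by rewrite cards0.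
  rewrite (leq_trans F1)// card_gt0; apply/set0Pn; exists set0.
  rewrite inE; apply/shattersP => S; rewrite subset0 => /eqP ->.
  by exists T => //; rewrite setI0.
have [x xT] : exists x, (x \in T0) != (x \in T1).
  apply/existsP; apply: contraNT T01 => /existsPn h.
  by apply/eqP/setP => x; have /negPn/eqP := h x.
pose G b := [set T in F | (x \in T) == b].
have Gm b : (#|G b| <= m)%N.
  rewrite -ltnS (leq_trans _ Fm)// proper_card//; apply/properP; split.
    by apply/subsetP => T; rewrite inE => /andP[].
  case: (eqVneq (x \in T0) b) => [e|ne].
    by exists T1 => //; rewrite inE T1F/= -e eq_sym.
  by exists T0 => //; rewrite inE T0F.
have FG : #|F| = (#|G true| + #|G false|)%N.
  rewrite -(cardsID [set T : {set K} | x \in T] F); apply: (f_equal2 addn);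
    by apply: eq_card => T; rewrite !inE ?eqb_id ?eqbF_neg// andbC.
have GF b : G b \subset F by apply/subsetP => T; rewrite inE => /andP[].
pose sh b := [set I | shatters (G b) I].
have shx b I : I \in sh b -> x \notin I.
  rewrite inE => /shattersP h; apply/negP => xI.
  have [|T TG] := h [set y in I | (y == x) ==> ~~ b].
    by apply/subsetP => y; rewrite inE => /andP[].
  move=> /setP/(_ x); rewrite !inE xI eqxx/= andbT.
  by move: TG; rewrite inE => /andP[_ /eqP ->]; case: b {sh h}.
rewrite FG (leq_trans (leq_add (IH _ (Gm true)) (IH _ (Gm false))))//.
rewrite -/(sh true) -/(sh false) -cardsUI.
pose sh2 := [set x |: I | I in sh true :&: sh false].
have -> : #|sh true :&: sh false| = #|sh2|.
  rewrite card_in_imset// => I J; rewrite !inE => /andP[It _] /andP[Jt _] IJ.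
  have xI : x \notin I by apply: (shx true); rewrite inE.
  have xJ : x \notin J by apply: (shx true); rewrite inE.
  by rewrite -(setU1K xI) -(setU1K xJ) IJ.
have <- : #|(sh true :|: sh false) :|: sh2| =
    (#|sh true :|: sh false| + #|sh2|)%N.
  apply/eqP; rewrite (leq_card_setU _ _).2 disjoint_subset.
  apply/subsetP => I; rewrite !inE => h.
  apply/negP => /imsetP[J _ IJ].
  have : x \notin I by case/orP: h => h; [apply: (shx true)|apply: (shx false)];
    rewrite inE.
  by rewrite IJ !inE eqxx.
apply: subset_leq_card; apply/subsetP => I; rewrite 3!inE => /orP[/orP[]|].
- by rewrite !inE; exact: shatters_sub.
- by rewrite !inE; exact: shatters_sub.
move=> /imsetP[J]; rewrite !inE => /andP[/shattersP ht /shattersP hf] ->.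
have xJ : x \notin J by apply: (shx true); rewrite inE; apply/shattersP.
apply/shattersP => S SJ.
have SxJ : S :\ x \subset J by rewrite subDset.
have [T TG TS] : exists2 T, T \in G (x \in S) & T :&: J = S :\ x.
  by case: (x \in S); [exact: ht|exact: hf].
exists T; first exact: (subsetP (GF _) _ TG).
apply/setP => y; have /setP/(_ y) := TS; rewrite !inE.
have [->|yx] := eqVneq y x; last by rewrite /= .
by rewrite /= andbT; move: TG; rewrite inE => /andP[_ /eqP].
Qed.

End pajor.

(** * Hoeffding's bound for random signs *)

Section hoeffding.
Context (R : realType).

(** Since 1 + y <= exp y, the two exponentials are at most 1/(1 - x) and 1/(1 + x), whose sum is
    2/(1 - x^2). *)
Lemma expR_addN_le (x : R) : `|x| <= 1 / 2 ->
  expR x + expR (- x) <= 2 * expR (2 * x ^+ 2).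
Proof.
rewrite ler_norml => /andP[x1 x2].
have h1 : expR x <= (1 - x)^-1.
  rewrite -[expR x]invrK -expRN lef_pV2 ?posrE ?expR_gt0//; last lra.
  exact: expR_ge1Dx.
have h2 : expR (- x) <= (1 + x)^-1.
  rewrite expRN lef_pV2 ?posrE ?expR_gt0//; last lra.
  exact: expR_ge1Dx.
apply: (le_trans (lerD h1 h2)).
apply: (@le_trans _ _ (2 * (1 + 2 * x ^+ 2))); last first.
  by rewrite ler_pM2l// expR_ge1Dx.
have -> : (1 - x)^-1 + (1 + x)^-1 = 2 / (1 - x ^+ 2).
  have a : 1 - x != 0 by apply: lt0r_neq0; lra.
  have b : 1 + x != 0 by apply: lt0r_neq0; lra.
  have c : 1 - x ^+ 2 != 0.
    by rewrite (_ : 1 - x ^+ 2 = (1 - x) * (1 + x)) ?mulf_neq0//; ring.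
  by field; rewrite a b c.
have x2' : x ^+ 2 <= 1 / 4 by nra.
rewrite ler_pdivrMr; nra.
Qed.

(** Chernoff's method, stated as a count of sign vectors: the indicator is at most exp(h(S - t)) for
    the signed sum S, and the sum of these exponentials over all sign vectors factors over the
    coordinates. *)
Lemma hoeffding_count n (d : 'I_n -> R) (h t : R) :
  (forall i, `|d i| <= 1) -> 0 <= h <= 1 / 2 ->
  \sum_(s : {ffun 'I_n -> bool}) (t < \sum_i (-1) ^+ s i * d i)%R%:R
    <= 2 ^+ n * expR (n%:R * (2 * h ^+ 2) - h * t).
Proof.
move=> d1 /andP[h0 h12].
apply: (@le_trans _ _ (\sum_(s : {ffun 'I_n -> bool})
    (\prod_i expR (h * ((-1) ^+ s i * d i))) * expR (- (h * t)))).
  apply: ler_sum => s _; rewrite -expR_sum -expRD -mulr_sumr -mulrBr.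
  case: ltP => [lt|_]; last exact: expR_ge0.
  rewrite -[leLHS]expR0 ler_expR mulr_ge0// subr_ge0; exact: ltW.
rewrite -mulr_suml expRD mulrA ler_pM2r ?expR_gt0//.
rewrite -(bigA_distr_bigA (fun i (b : bool) => expR (h * ((-1) ^+ b * d i)))).
rewrite expRM_natl -exprMn -[X in _ <= _ ^+ X]card_ord -prodr_const.
apply: ler_prod => i _; apply/andP; split.
  by apply: sumr_ge0 => b _; exact: expR_ge0.
rewrite big_bool /= expr1 expr0 mul1r mulN1r mulrN addrC.
apply: le_trans (expR_addN_le _) _.
  by rewrite normrM ger0_norm// -[leRHS]mulr1 ler_pM.
rewrite ler_pM2l// ler_expR ler_pM2l// -real_normK ?num_real//.
rewrite ler_pXn2r ?nnegrE//.
by rewrite normrM ger0_norm// ler_piMr.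
Qed.

End hoeffding.

(** * Independent samples from a finite weighted set *)

Section finite_sampling.
Context (R : realType) (Om : finType) (w : Om -> R).
Hypothesis w0 : forall o, 0 <= w o.
Hypothesis w1 : \sum_o w o = 1.

Definition weight (K : finType) (f : {ffun K -> Om}) : R := \prod_k w (f k).

Definition wprob (A : pred Om) : R := \sum_o w o * (A o)%:R.

Definition emp (K : finType) (f : {ffun K -> Om}) (A : pred Om) : R :=
  (\sum_k (A (f k))%:R) / #|K|%:R.

Lemma weight_ge0 (K : finType) (f : {ffun K -> Om}) : 0 <= weight f.
Proof. by apply: prodr_ge0 => k _. Qed.

Lemma sum_weight (K : finType) : \sum_(f : {ffun K -> Om}) weight f = 1.
Proof. by rewrite /weight -(bigA_distr_bigA (fun=> w)) big1. Qed.

Lemma ler_sum_weight (K : finType) (g h : {ffun K -> Om} -> R) :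
  (forall f, g f <= h f) -> \sum_f weight f * g f <= \sum_f weight f * h f.
Proof. by move=> gh; apply: ler_sum => f _; rewrite ler_wpM2l ?weight_ge0. Qed.

(** The [f] restricting to a given [h] form a product family: one value prescribed at each index in
    the image of [i], total mass 1 at every other index. *)
Lemma sum_weight_marginal (K K' : finType) (i : K' -> K)
    (g : {ffun K' -> Om} -> R) : injective i ->
  \sum_f weight f * g [ffun k => f (i k)] = \sum_h weight h * g h.
Proof.
move=> inji; rewrite (partition_big (fun f : {ffun K -> Om} => [ffun k => f (i k)])
  xpredT)//=.
apply: eq_bigr => h _.
transitivity ((\sum_(f : {ffun K -> Om} | [ffun k => f (i k)] == h) weight f) * g h).
  by rewrite mulr_suml; apply: eq_bigr => f /eqP ->.
congr (_ * _).
pose F (k : K) : pred Om := fun o => [forall k', (i k' == k) ==> (h k' == o)].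
rewrite (eq_bigl (fun f => f \in family F)); last first.
  move=> f; apply/eqP/familyP => [fh k|fF].
    by apply/forallP => k'; apply/implyP => /eqP <-; rewrite -fh ffunE.
  by apply/ffunP => k; rewrite ffunE; have /forallP/(_ k) := fF (i k);
    rewrite eqxx => /eqP.
rewrite /weight -(bigA_distr_big_dep _ (fun _ o => w o)).
rewrite (bigID (fun k => k \in codom i))/= [X in _ * X]big1 ?mulr1; last first.
  move=> k kN; rewrite -[RHS]w1; apply: eq_bigl => o.
  apply/forallP => k'; apply/implyP => /eqP ik; move: kN.
  by rewrite -ik codom_f.
rewrite -big_uniq /=; last by rewrite map_inj_uniq ?enum_uniq.
rewrite big_image/=; apply: eq_bigr => k' _.
rewrite (big_pred1 (h k'))// => o; apply/forallP/eqP => [/(_ k')|-> k].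
  by rewrite eqxx => /eqP.
by apply/implyP => /eqP/inji ->.
Qed.

Lemma wprob_ge0 A : 0 <= wprob A.
Proof. by apply: sumr_ge0 => o _; rewrite mulr_ge0. Qed.

Lemma wprob_le1 A : wprob A <= 1.
Proof.
rewrite -w1; apply: ler_sum => o _.
by rewrite -[leRHS]mulr1 ler_wpM2l// lern1; case: (A o).
Qed.

(** The variance computation behind Chebyshev's inequality: [d] is the centred indicator, so the
    mixed terms vanish and each of the [#|K|] diagonal terms is at most 1. *)
Lemma sum_weight_emp_dev (K : finType) (A : pred Om) : (0 < #|K|)%N ->
  \sum_(f : {ffun K -> Om}) weight f * (emp f A - wprob A) ^+ 2
    <= #|K|%:R^-1.
Proof.
move=> K0; pose d o : R := (A o)%:R - wprob A.
have NK : #|K|%:R != 0 :> R by rewrite pnatr_eq0 -lt0n.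
have Ed : \sum_o w o * d o = 0.
  rewrite /d (eq_bigr (fun o => w o * (A o)%:R - w o * wprob A)); last first.
    by move=> o _; rewrite mulrBr.
  by rewrite sumrB -mulr_suml w1 mul1r subrr.
have d1 o : d o ^+ 2 <= 1.
  have := wprob_ge0 A; have := wprob_le1 A; rewrite /d.
  by case: (A o) => /=; nra.
have dev (f : {ffun K -> Om}) : (emp f A - wprob A) ^+ 2 =
    #|K|%:R ^- 2 * \sum_k \sum_l d (f k) * d (f l) :> R.
  transitivity (#|K|%:R ^- 2 * (\sum_k d (f k)) ^+ 2); last first.
    congr (_ * _); rewrite expr2 mulr_suml.
    by apply: eq_bigr => k _; rewrite mulr_sumr.
  rewrite /d sumrB sumr_const /emp -[wprob A *+ _]mulr_natl.
  by field.
rewrite (eq_bigr (fun f => #|K|%:R ^- 2 *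
    \sum_k \sum_l weight f * (d (f k) * d (f l)))); last first.
  move=> f _; rewrite dev mulrCA mulr_sumr; congr (_ * _).
  by apply: eq_bigr => k _; rewrite mulr_sumr.
rewrite -mulr_sumr exchange_big /=.
apply: (@le_trans _ _ (#|K|%:R ^- 2 * \sum_(k : K) 1)); last first.
  rewrite sumr_const.
  by rewrite -exprVn expr2 -mulrA mulVf ?mulr1.
rewrite ler_pM2l ?invr_gt0 ?exprn_gt0 ?ltr0n//; apply: ler_sum => k _.
rewrite exchange_big (bigD1 k)//= [X in _ + X]big1 ?addr0; last first.
  move=> l lk.
  transitivity (\sum_(f : {ffun K -> Om}) \prod_i (w (f i) *
     ((if i == k then d (f i) else 1) * (if i == l then d (f i) else 1)))).
    apply: eq_bigr => f _; rewrite !big_split/=; congr (_ * (_ * _)).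
      by rewrite -big_mkcond/= big_pred1_eq.
    by rewrite -big_mkcond/= big_pred1_eq.
  rewrite -(bigA_distr_bigA (fun i o => w o *
    ((if i == k then d o else 1) * (if i == l then d o else 1)))).
  rewrite (bigD1 k)//= [X in X * _](_ : _ = 0) ?mul0r// -[RHS]Ed.
  by apply: eq_bigr => o _; rewrite eqxx eq_sym (negbTE lk) mulr1.
rewrite -[leRHS](@sum_weight K); apply: ler_sum => f _.
by rewrite -[leRHS]mulr1 ler_wpM2l ?weight_ge0// -expr2.
Qed.

End finite_sampling.

(** * Ghost sample, random swaps and shattered subsamples *)

Section symmetrization.
Import boot.fintype boot.finset.
Local Open Scope set_scope.
Context (R : realType) (Om : finType) (w : Om -> R).
Hypothesis w0 : forall o, 0 <= w o.
Hypothesis w1 : \sum_o w o = 1.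
Context (J : finType) (C : J -> pred Om) (n : nat) (e : R).
Hypothesis e0 : 0 < e.
Hypothesis e1 : e <= 1.
Hypothesis ne : 512 / e ^+ 3 <= n%:R.

Local Notation K := ('I_n * bool)%type.
Implicit Types (f : {ffun K -> Om}) (s : {ffun 'I_n -> bool}) (T : {set K}).

Definition half_sample (b : bool) f : {ffun 'I_n -> Om} := [ffun i => f (i, b)].

(** Fubini for the double sample: the boolean distinguishes a sample from its independent ghost. *)
Lemma sum_weight_halves (g : {ffun 'I_n -> Om} -> {ffun 'I_n -> Om} -> R) :
  \sum_f weight w f * g (half_sample true f) (half_sample false f) =
  \sum_(f1 : {ffun 'I_n -> Om}) weight w f1 * \sum_(f2 : {ffun 'I_n -> Om}) weight
    w f2 * g f1 f2.
Proof.
under [RHS]eq_bigr do rewrite mulr_sumr.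
rewrite pair_bigA /=.
rewrite (reindex (fun ff : {ffun 'I_n -> Om} * {ffun 'I_n -> Om} =>
  [ffun k : K => if k.2 then ff.1 k.1 else ff.2 k.1]))/=; last first.
  exists (fun f => (half_sample true f, half_sample false f)).
    move=> [f1 f2] _; congr pair; apply/ffunP => i; by rewrite !ffunE.
  by move=> f _; apply/ffunP => -[i []]; rewrite !ffunE.
apply: eq_bigr => -[f1 f2] _ /=; rewrite mulrA; congr (_ * g _ _).
- rewrite /weight -big_split /=.
  transitivity (\prod_i \prod_(b : bool) w (if b then f1 i else f2 i)).
    by rewrite pair_bigA; apply: eq_bigr => k _; rewrite ffunE.
  by apply: eq_bigr => i _; rewrite big_bool.
- by apply/ffunP => i; rewrite !ffunE.
- by apply/ffunP => i; rewrite !ffunE.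
Qed.

Definition swap_sample s f : {ffun K -> Om} :=
  [ffun k => f (k.1, k.2 (+) s k.1)].

Lemma weight_swap s f : weight w (swap_sample s f) = weight w f.
Proof.
rewrite /weight [RHS](reindex (fun k : K => (k.1, k.2 (+) s k.1)))/=; last first.
  by exists (fun k : K => (k.1, k.2 (+) s k.1)) => -[i b] _ /=; rewrite addbK.
by apply: eq_bigr => k _; rewrite ffunE.
Qed.

Lemma sum_weight_swap s (g : {ffun K -> Om} -> R) :
  \sum_f weight w f * g (swap_sample s f) = \sum_f weight w f * g f.
Proof.
rewrite [RHS](reindex (swap_sample s))/=.
  by apply: eq_bigr => f _; rewrite weight_swap.
by exists (swap_sample s) => f _; apply/ffunP => -[i b]; rewrite !ffunE /= addbK.
Qed.

Definition deviates (f : {ffun 'I_n -> Om}) :=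
  [exists j, e < `|emp R f (C j) - wprob w (C j)|].

Definition halves_deviate f := [exists j,
  e / 2 < `|emp R (half_sample true f) (C j) - emp R (half_sample false f) (C j)|].

Lemma sample_size_gt0 : (0 < n)%N.
Proof.
rewrite -(ltr0n R); apply: lt_le_trans ne.
by rewrite divr_gt0 ?ltr0n ?exprn_gt0.
Qed.

(** If [f1] deviates by more than [e] at some [j], then by Chebyshev the ghost is within [e / 2] of
    the true value at this same [j] with probability at least 1/2, and there the halves differ by
    more than [e / 2]. *)
Lemma ghost_sample : e < \sum_(f : {ffun 'I_n -> Om}) weight w f * (deviates f)%:R ->
  e / 2 <= \sum_f weight w f * (halves_deviate f)%:R.
Proof.
move=> he.
have := sum_weight_halves (fun f1 f2 : {ffun 'I_n -> Om} =>
  [exists j, e / 2 < `|emp R f1 (C j) - emp R f2 (C j)|]%:R).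
rewrite /halves_deviate => ->.
apply: (@le_trans _ _ (\sum_(f : {ffun 'I_n -> Om}) weight w f * ((deviates f)%:R /
  2))).
  under eq_bigr do rewrite mulrA.
  by rewrite -mulr_suml ler_pM2r ?invr_gt0//; exact: ltW.
apply: ler_sum_weight => // f1; case: (boolP (deviates f1)) => [|_]; last first.
  by rewrite mul0r; apply: sumr_ge0 => f2 _; rewrite mulr_ge0 ?weight_ge0.
move=> /existsP[j dj].
apply: (@le_trans _ _ (1 - 4 / e ^+ 2 * n%:R^-1)).
  have : n%:R^-1 <= e ^+ 3 / 512.
    rewrite -[leRHS]invrK lef_pV2 ?posrE ?invr_gt0 ?divr_gt0 ?exprn_gt0 ?ltr0n
      ?sample_size_gt0//.
    by rewrite invf_div.
  rewrite -(@ler_pM2l _ (4 / e ^+ 2)) ?divr_gt0 ?exprn_gt0//.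
  have -> : 4 / e ^+ 2 * (e ^+ 3 / 512) = e / 128 by field; rewrite gt_eqF.
  by move: (4 / e ^+ 2 / n%:R) => y ye; rewrite /=; move: e1; lra.
(* Chebyshev pointwise: the indicator is at least 1 - (2x/e)^2, where x is the deviation of [f2] at
   [j]; this is negative once |x| > e/2. *)
apply: (@le_trans _ _ (\sum_(f2 : {ffun 'I_n -> Om}) weight w f2 *
    (1 - 4 / e ^+ 2 * (emp R f2 (C j) - wprob w (C j)) ^+ 2))).
  under [leRHS]eq_bigr do rewrite mulrBr mulr1 mulrCA.
  rewrite sumrB (sum_weight w1) lerB// -mulr_sumr ler_pM2l ?divr_gt0 ?exprn_gt0//.
  by have := @sum_weight_emp_dev _ _ _ w0 w1 'I_n (C j); rewrite card_ord; apply;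
    exact: sample_size_gt0.
apply: ler_sum_weight => // f2.
set x := emp R f2 (C j) - wprob w (C j).
have e20 : 0 < 4 / e ^+ 2 by rewrite divr_gt0 ?exprn_gt0.
case: (lerP (`|x|) (e / 2)) => xe.
  suff -> : [exists j, e / 2 < `|emp R f1 (C j) - emp R f2 (C j)|].
    by rewrite gerBl mulr_ge0 ?sqr_ge0// ltW.
  apply/existsP; exists j.
  have : `|emp R f1 (C j) - wprob w (C j)| <= `|emp R f1 (C j) - emp R f2 (C j)| + `|x|.
    by rewrite (le_trans _ (ler_normD _ _))// /x addrA subrK.
  lra.
apply: (@le_trans _ _ 0); last exact: ler0n.
rewrite subr_le0 -(@ler_pM2l _ (e ^+ 2 / 4)) ?divr_gt0 ?exprn_gt0// mulr1.
have -> : e ^+ 2 / 4 * (4 / e ^+ 2 * x ^+ 2) = x ^+ 2.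
  by field; rewrite gt_eqF.
rewrite -[x ^+ 2]real_normK ?num_real//.
have -> : e ^+ 2 / 4 = (e / 2) ^+ 2 by field.
by rewrite ler_pXn2r ?nnegrE ?normr_ge0 ?(ltW xe)// divr_ge0// ltW.
Qed.

Definition trace f (j : J) : {set K} := [set k | C j (f k)].
Definition traces f : {set {set K}} := [set trace f j | j : J].

Definition jump T (i : 'I_n) : R := ((i, true) \in T)%:R - ((i, false) \in T)%:R.

(** Swapping only changes signs: [T] is a trace of the unswapped [f], so it ranges over a family
    independent of [s]. *)
Lemma halves_deviate_swap s f : halves_deviate (swap_sample s f) ->
  exists2 T, T \in traces f & n%:R * (e / 2) < `|\sum_i (-1) ^+ s i * jump T i|.
Proof.
move=> /existsP[j h]; exists (trace f j); first exact: imset_f.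
suff <- : n%:R * (emp R (half_sample true (swap_sample s f)) (C j) -
    emp R (half_sample false (swap_sample s f)) (C j)) =
    \sum_i (-1) ^+ s i * jump (trace f j) i.
  by rewrite normrM ger0_norm// ltr_pM2l// ltr0n sample_size_gt0.
rewrite /emp card_ord -mulrBl mulrC mulfVK ?pnatr_eq0 -?lt0n ?sample_size_gt0//.
rewrite -sumrB; apply: eq_bigr => i _; rewrite !ffunE /= /jump !inE.
by case: (s i); rewrite /= ?expr1 ?expr0 ?mul1r ?mulN1r ?opprB.
Qed.

Lemma norm_jump T i : `|jump T i| <= 1.
Proof.
by rewrite /jump; case: (_ \in T); case: (_ \in T);
  rewrite ?subrr ?subr0 ?sub0r ?normrN ?normr0 ?normr1.
Qed.

(** Union bound over the distinct traces of [f] and the two signs of the deviation. Hoeffding's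
    bound with [h = e / 8] and [t = n * e / 2] has exponent n e^2/32 - n e^2/16. *)
Lemma count_halves_deviate f :
  \sum_s (halves_deviate (swap_sample s f))%:R <=
  #|traces f|%:R * (2 ^+ n * (2 * expR (- (n%:R * e ^+ 2 / 32)))) :> R.
Proof.
pose t : R := n%:R * (e / 2).
apply: (@le_trans _ _ (\sum_(s : {ffun 'I_n -> bool}) \sum_(T in traces f)
   ((t < \sum_i (-1) ^+ s i * jump T i)%R%:R +
    (t < \sum_i (-1) ^+ s i * (- jump T i))%R%:R))).
  apply: ler_sum => s _.
  case: (boolP (halves_deviate _)) => [|_]; last first.
    by apply: sumr_ge0 => T _; rewrite addr_ge0.
  move=> /halves_deviate_swap[T TF]; rewrite -/t lter_normr.
  rewrite (bigD1 T)//= => h; rewrite -[leLHS]addr0; apply: lerD; last first.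
    by apply: sumr_ge0 => ? _; rewrite addr_ge0.
  have -> : \sum_i (-1) ^+ s i * - jump T i = - \sum_i (-1) ^+ s i * jump T i.
    by rewrite -sumrN; apply: eq_bigr => i _; rewrite mulrN.
  by case/orP: h => ->; rewrite ?lerDl ?lerDr.
rewrite exchange_big /= mulr_natl -sumr_const; apply: ler_sum => T _.
have E d : (forall i, `|d i| <= 1) ->
    \sum_(s : {ffun 'I_n -> bool}) (t < \sum_i (-1) ^+ s i * d i)%R%:R
     <= 2 ^+ n * expR (- (n%:R * e ^+ 2 / 32)) :> R.
  move=> d1; apply: le_trans (hoeffding_count t d1 (_ : 0 <= e / 8 <= 1 / 2)) _.
    by apply/andP; split; move: e0 e1; lra.
  by rewrite ler_pM2l ?exprn_gt0// ler_expR /t; lra.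
rewrite big_split/=.
apply: le_trans (lerD (E _ (norm_jump T)) (E (fun i => - jump T i) _)) _.
  by move=> i; rewrite normrN norm_jump.
by rewrite le_eqVlt; apply/orP; left; apply/eqP; ring.
Qed.

(** With [a := 256 / e ^+ 2], the sets of cardinality less than [vc_rate * N] in
    an [N]-element set number at most [expR (a * vc_rate * N) * (1 + expR (- a)) ^+ N],
    which Hoeffding's bound [expR (- (n * e ^+ 2 / 32))], with [N = 2 * n], beats. *)
Definition vc_rate : R := (e ^+ 2 / 256) ^+ 2.

Definition large_shattered f := [exists I : {set K},
  (vc_rate * #|{: K}|%:R <= #|I|%:R) && shatters (traces f) I].

(** Both factors of the bound are at most exp(N e^2/256) with N = 2n: the first because
    [a * vc_rate] is [e ^+ 2 / 256], the second because [expR (- a) <= 1 / a]. The resulting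
    exponent is half of Hoeffding's. *)
Lemma card_small_sets :
  #|[set I : {set K} | #|I|%:R < vc_rate * #|{: K}|%:R]%R|%:R
    <= expR (n%:R * e ^+ 2 / 64) :> R.
Proof.
pose a : R := 256 / e ^+ 2.
have a0 : 0 < a by rewrite divr_gt0 ?exprn_gt0.
have K2 : #|{: K}|%:R = 2 * n%:R :> R.
  by rewrite card_prod card_ord card_bool natrM mulrC.
apply: (@le_trans _ _ (\sum_(I : {set K}) expR (a * (vc_rate * #|{: K}|%:R)) * expR
  (- a) ^+ #|I|)).
  rewrite -sum1_card natr_sum big_mkcond/=; apply: ler_sum => I _.
  rewrite inE -expRM_natl -expRD; case: ifPn => [lt|_]; last exact: expR_ge0.
  rewrite -[leLHS]expR0 ler_expR mulrN [X in _ - X]mulrC -mulrBr mulr_ge0 ?ltW//.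
  by rewrite subr_gt0.
rewrite -mulr_sumr.
have -> : \sum_(I : {set K}) expR (- a) ^+ #|I| = (expR (- a) + 1) ^+ #|{: K}|.
  transitivity (\prod_(k : K) (expR (- a) + 1)); last by rewrite prodr_const.
  rewrite bigA_distr; apply: eq_bigr => I _.
  by rewrite -big_mkcond/= prodr_const.
have ea : expR (- a) <= e ^+ 2 / 256.
  rewrite expRN -[leRHS]invrK lef_pV2 ?posrE ?invr_gt0 ?divr_gt0 ?expR_gt0 ?exprn_gt0//.
  by rewrite invf_div (le_trans _ (expR_ge1Dx _))// /a lerDr.
apply: (@le_trans _ _ (expR (a * (vc_rate * #|{: K}|%:R)) * expR (e ^+ 2 / 256) ^+
  #|{: K}|)).
  rewrite ler_pM2l ?expR_gt0//; apply: lerXn2r; rewrite ?nnegrE ?addr_ge0 ?expR_ge0//.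
  by rewrite (le_trans _ (expR_ge1Dx _))// addrC lerD2l.
rewrite -expRM_natl -expRD ler_expR K2 /a /vc_rate.
rewrite le_eqVlt; apply/orP; left; apply/eqP; field.
by rewrite gt_eqF.
Qed.

(** The weight is invariant under swaps, so the event may be averaged over [s] for each [f]. Without
    a large shattered set, [pajor] bounds the number of traces by that of the small sets, and the
    average is at most [e / 4]; this is subtracted from the [e / 2] of [ghost_sample]. The constant
    512 makes n e^2/64 at least 8/e, so that the remaining exponential is at most [e / 8]. *)
Lemma shattering_sample : e < \sum_(f : {ffun 'I_n -> Om}) weight w f * (deviates
  f)%:R ->
  e / 4 <= \sum_f weight w f * (large_shattered f)%:R.
Proof.
move=> /ghost_sample he.
have small : expR (n%:R * e ^+ 2 / 64) * (2 * expR (- (n%:R * e ^+ 2 / 32))) <= e / 4.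
  have -> : expR (n%:R * e ^+ 2 / 64) * (2 * expR (- (n%:R * e ^+ 2 / 32))) =
     2 * expR (- (n%:R * e ^+ 2 / 64)).
    by rewrite mulrCA -expRD; congr (_ * expR _); field.
  have ge : n%:R * e ^+ 2 / 64 >= 8 / e.
    have -> : 8 / e = 512 / e ^+ 3 * (e ^+ 2 / 64) by field; rewrite gt_eqF.
    by rewrite -[leRHS]mulrA ler_pM2r ?divr_gt0 ?exprn_gt0.
  have : expR (- (n%:R * e ^+ 2 / 64)) <= e / 8.
    rewrite expRN -[leRHS]invrK lef_pV2 ?posrE ?invr_gt0 ?divr_gt0 ?expR_gt0//.
    rewrite invf_div (le_trans ge)// (le_trans _ (expR_ge1Dx _))//.
    by rewrite lerDr.
  lra.
have key f : 2 ^- n * \sum_s (halves_deviate (swap_sample s f))%:R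
    <= (large_shattered f)%:R + e / 4 :> R.
  case: (boolP (large_shattered f)) => [_|ns].
    rewrite -[leLHS]addr0; apply: lerD; last by rewrite divr_ge0 ?ltW.
    rewrite ler_pdivrMl ?exprn_gt0// mulr1 -natrX.
    have -> : (2 ^ n)%N = #|{ffun 'I_n -> bool}| by rewrite card_ffun card_bool
      card_ord.
    rewrite -sum1_card natr_sum; apply: ler_sum => s _.
    by rewrite ler_nat; case: halves_deviate.
  rewrite add0r ler_pdivrMl ?exprn_gt0//.
  apply: le_trans (count_halves_deviate f) _.
  rewrite mulrCA ler_pM2l ?exprn_gt0//.
  apply: le_trans small; rewrite ler_pM2r ?mulr_gt0 ?expR_gt0//.
  apply: le_trans card_small_sets; rewrite ler_nat.
  apply: leq_trans (pajor _) _; apply: subset_leq_card.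
  apply/subsetP => I; rewrite !inE => sI; rewrite ltNge; apply/negP => le.
  by move/existsPn/(_ I) : ns; rewrite le sI.
have : e / 2 <= \sum_f weight w f * ((large_shattered f)%:R + e / 4).
  apply: le_trans he _.
  apply: le_trans (ler_sum_weight w0 key).
  under [leRHS]eq_bigr do rewrite mulrCA mulr_sumr.
  rewrite -mulr_sumr exchange_big/=.
  rewrite (eq_bigr (fun _ : {ffun 'I_n -> bool} => \sum_f weight w f *
    (halves_deviate f)%:R)); last first.
    by move=> s _; rewrite (sum_weight_swap s (fun f => (halves_deviate f)%:R)).
  rewrite sumr_const card_ffun card_bool card_ord -[X in _ * X]mulr_natl natrX mulrA.
  by rewrite mulVf ?mul1r// expf_neq0.
under eq_bigr do rewrite mulrDr.
rewrite big_split/= -mulr_suml (sum_weight w1) mul1r; lra.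
Qed.

End symmetrization.

Local Open Scope classical_set_scope.

(** * Finite codings of a probability space *)

Section cells.
Context d (T : measurableType d) (R : realType) (P : probability T R).
Context (Om : finType) (c : T -> Om).
Hypothesis mc : forall o, measurable (c @^-1` [set o]).

Lemma measurable_cells (A : pred Om) : measurable [set x | A (c x)].
Proof.
rewrite (_ : [set _ | _] = \big[setU/set0]_(o | A o) (c @^-1` [set o])).
  exact: bigsetU_measurable.
rewrite -bigcup_pred; apply/seteqP; split => [x Ax|x [y /= Ay yx]].
  by exists (c x).
by rewrite /= yx.
Qed.

Lemma measure_cells (A : pred Om) :
  P [set x | A (c x)] = (\sum_(o | A o) P (c @^-1` [set o]))%E.
Proof.
suff H r : uniq r -> P [set x | c x \in r] = (\sum_(o <- r) P (c @^-1` [set o]))%E.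
  have := H _ (enum_uniq A); rewrite big_enum/= => <-; congr (P _).
  by apply/seteqP; split => x /=; rewrite mem_enum.
elim: r => [_|o r IH /= /andP[or /IH {}IH]].
  by rewrite big_nil (_ : [set _ | _] = set0) ?measure0//; apply/seteqP; split.
rewrite big_cons -IH -measureU//.
- by congr (P _); apply/seteqP; split => x /=; rewrite inE => /predU1P.
- exact: (measurable_cells (fun o => o \in r)).
- by apply/seteqP; split => x //= [-> rx]; rewrite rx in or.
Qed.

Definition cellw (o : Om) : R := fine (P (c @^-1` [set o])).

Lemma cellw_ge0 o : 0 <= cellw o.
Proof. by rewrite /cellw fine_ge0. Qed.

Lemma cellwE o : P (c @^-1` [set o]) = (cellw o)%:E.
Proof. by rewrite fineK ?fin_num_measure. Qed.

Lemma measure_cells_fin (A : pred Om) :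
  P [set x | A (c x)] = (\sum_(o | A o) cellw o)%:E.
Proof.
by rewrite measure_cells -sumEFin; apply: eq_bigr => o _; rewrite cellwE.
Qed.

Lemma sum_cellw : \sum_o cellw o = 1.
Proof.
apply: EFin_inj; rewrite -(measure_cells_fin xpredT) -(@probability_setT _ _ _ P).
by congr (P _); apply/seteqP; split.
Qed.

Lemma wprob_cellw (A : pred Om) : wprob cellw A = fine (P [set x | A (c x)]).
Proof.
rewrite measure_cells_fin/= /wprob [RHS]big_mkcond/=; apply: eq_bigr => o _.
by case: (A o); rewrite ?mulr1 ?mulr0.
Qed.

End cells.

Section tuple_cells.
Context d (T : measurableType d) (R : realType) (P : probability T R).
Context (Om : finType) (c : T -> Om) (k : nat).
Hypothesis mc : forall o, measurable (c @^-1` [set o]).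

Definition tuple_cell (t : k.-tuple T) : {ffun 'I_k -> Om} :=
  [ffun i => c (tnth t i)].

Lemma tuple_cell_preimage f : tuple_cell @^-1` [set f] =
  [set t | forall i, (c @^-1` [set f i]) (tnth t i)].
Proof.
apply/seteqP; split => [t /= <- i|t /= h]; first by rewrite ffunE.
by apply/ffunP => i; rewrite ffunE.
Qed.

Lemma measurable_tuple_box (A : 'I_k -> set T) : (forall i, measurable (A i)) ->
  measurable [set t : k.-tuple T | forall i, A i (tnth t i)].
Proof.
move=> mA; rewrite (_ : [set _ | _] =
    \big[setI/setT]_(i < k) ((@tnth k T)^~ i @^-1` A i)).
  apply: bigsetI_measurable => i _.
  by rewrite -[X in measurable X]setTI; exact: measurable_tnth.
rewrite -bigcap_seq; apply/seteqP; split => t /= At i; first by move=> _; apply: At.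
by apply: At; rewrite /= mem_index_enum.
Qed.

Lemma measurable_tuple_cell f : measurable (tuple_cell @^-1` [set f]).
Proof.
rewrite tuple_cell_preimage.
exact: (@measurable_tuple_box (fun i => c @^-1` [set f i])).
Qed.

(** The passage from the product measure to finite sums: a tuple of cells is a box. *)
Lemma power_prob_cells (A : pred {ffun 'I_k -> Om}) :
  power_prob P k [set t | A (tuple_cell t)] =
  (\sum_f weight (cellw P c) f * (A f)%:R)%:E.
Proof.
rewrite (measure_cells _ measurable_tuple_cell) -sumEFin big_mkcond/=.
apply: eq_bigr => f _; case: (A f); rewrite ?mulr0// mulr1.
rewrite tuple_cell_preimage (@power_prob_box _ _ _ _ _ (fun i => c @^-1` [set f
  i]))// /weight -prodEFin.
by apply: eq_bigr => i _; exact: cellwE.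
Qed.

End tuple_cells.

Lemma measurable_asbool d (T : measurableType d) (A : set T) (b : bool) :
  measurable A ->
  measurable [set x | `[< A x >] = b].
Proof.
move=> mA; case: b.
  rewrite (_ : [set _ | _] = A)//.
  by apply/seteqP; split => x /=; [move/asboolP|move=> ?; apply/asboolP].
rewrite (_ : [set _ | _] = ~` A); first exact: measurableC.
by apply/seteqP; split => x /=; [move/asboolP|move=> ?; apply/asboolP].
Qed.

(** The average depends only on the pattern of memberships in [Y], one of finitely many. *)
Lemma measurable_Av d (T : measurableType d) (R : realType) n (Y : set T) (B : set R) :
  measurable Y -> measurable [set t : n.-tuple T | B (Av R t Y)].
Proof.
move=> mY; pose c x := `[< Y x >].
rewrite (_ : mkset _ = [set t | (fun f : {ffun 'I_n -> bool} =>
    `[< B (#|[pred i | f i]|%:R / n%:R) >]) (tuple_cell c t)]).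
  apply: (@measurable_cells _ _ _ (@tuple_cell _ _ _ c n) _ (fun f : {ffun 'I_n ->
    bool} =>
    `[< B (#|[pred i | f i]|%:R / n%:R) >])) => f.
  by apply: measurable_tuple_cell => b; exact: measurable_asbool.
have E t : Av R t Y = #|[pred i | (@tuple_cell _ _ _ c n t) i]|%:R / n%:R.
  by rewrite /Av; congr (_%:R / _); apply: eq_card => i; rewrite !inE ffunE.
by apply/funext => t /=; rewrite E; apply/propext; split => /asboolP.
Qed.

Lemma measurable_Av_deviation d (T : measurableType d) (R : realType) n r
    (Y : nat -> set T) (c : nat -> R) (e : R) : (forall j, measurable (Y j)) ->
  measurable [set t : n.-tuple T | exists2 j, (j < r)%N & e < `|Av R t (Y j) - c j|].
Proof.
move=> mY; rewrite (_ : mkset _ = \bigcup_(j in [set j | (j < r)%N])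
    [set t | [set x | e < `|x - c j|] (Av R t (Y j))]).
  by apply: bigcup_measurable => j _; exact: measurable_Av.
by apply/seteqP; split => t /= [j ? ?]; exists j.
Qed.

(** * Random subtuples of a sample and the first moment method *)

Section selection.
Context (R : realType) (Om : finType) (w : Om -> R).
Hypothesis w0 : forall o, 0 <= w o.
Hypothesis w1 : \sum_o w o = 1.

(** Along an injective [i] the selected points form an independent [k]-sample; there are at most
    [#|K| ^ k] such [i]. *)
Lemma sum_weight_inj (K : finType) k (B : pred {ffun 'I_k -> Om}) :
  \sum_f weight w f * (\sum_(i : {ffun 'I_k -> K})
     (injectiveb i && B [ffun l => f (i l)])%:R)
  <= #|K|%:R ^+ k * \sum_h weight w h * (B h)%:R.
Proof.
under eq_bigr do rewrite mulr_sumr.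
rewrite exchange_big/= -[X in _ ^+ X]card_ord -natrX -card_ffun mulr_natl -sumr_const.
apply: ler_sum => i _; case: injectiveP => [inji|_].
  by rewrite (sum_weight_marginal w1 (fun h => (B h)%:R) inji).
by rewrite big1 ?sumr_ge0// => [f _|f _]; rewrite /= ?mulr0// mulr_ge0 ?weight_ge0.
Qed.

Lemma exists_sample (K : finType) (Q : pred {ffun K -> Om})
    (Z : {ffun K -> Om} -> R) :
  (forall f, 0 <= Z f) ->
  \sum_f weight w f * Z f < \sum_f weight w f * (Q f)%:R ->
  exists2 f, Q f & Z f < 1.
Proof.
move=> Z0; apply: contraPP => /forall2NP h; apply/negP; rewrite -leNgt.
apply: ler_sum_weight => // f; have [/negP/negbTE ->//|/negP] := h f.
by rewrite -leNgt => ?; case: (Q f).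
Qed.

End selection.

(** * Shattering in terms of bit sequences *)

Section shattering.

(** Words are padded with [false], so that prefixes of all lengths live in the one type
    [nat -> bool]. *)
Definition bits r (u : {ffun 'I_r -> bool}) (j : nat) : bool :=
  if insub j is Some i then u i else false.

Definition trunc r (b : nat -> bool) : {ffun 'I_r -> bool} := [ffun j : 'I_r => b j].

Lemma bits_trunc r b j : (j < r)%N -> bits (trunc r b) j = b j.
Proof. by move=> jr; rewrite /bits insubT ffunE. Qed.

Definition bits_shattered k s (b : 'I_k -> nat -> bool) : bool :=
  [forall I : {set 'I_k}, [exists j : 'I_s, [forall i, b i j == (i \notin I)]]].

Lemma bits_shatteredP k s (b : 'I_k -> nat -> bool) :
  reflect (forall I : {set 'I_k}, exists2 j, (j < s)%N & forall i, b i j = (i \notin I))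
    (bits_shattered s b).
Proof.
apply: (iffP forallP) => h I.
  by have /existsP[j /forallP bj] := h I; exists j => // i; apply/eqP.
have [j js bj] := h I; apply/existsP; exists (Ordinal js).
by apply/forallP => i; rewrite bj.
Qed.

Lemma bits_shattered_le k s r (b : 'I_k -> nat -> bool) : (s <= r)%N ->
  bits_shattered s b -> bits_shattered r b.
Proof.
move=> sr /bits_shatteredP h; apply/bits_shatteredP => I.
by have [j js bj] := h I; exists j => //; exact: leq_trans sr.
Qed.

Lemma eq_bits_shattered k s (b b' : 'I_k -> nat -> bool) :
  (forall i j, (j < s)%N -> b i j = b' i j) ->
  bits_shattered s b = bits_shattered s b'.
Proof.
move=> bb'; apply/bits_shatteredP/bits_shatteredP => h I;
  have [j js bj] := h I; exists j => // i; rewrite -bj ?bb'//.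
Qed.

End shattering.

Section stage.
Context d (T : measurableType d) (R : realType) (P : probability T R).
Context (D : nat -> set T) (X : set T).
Hypothesis mD : forall j, measurable (D j).
Hypothesis mX : measurable X.

Definition code (x : T) (j : nat) : bool := `[< D j x >].

Lemma measurable_trunc r (u : {ffun 'I_r -> bool}) :
  measurable ((trunc r \o code) @^-1` [set u]).
Proof.
rewrite (_ : _ @^-1` _ =
    \big[setI/setT]_(j < r) [set x | `[< D j x >] = u j]).
  by apply: bigsetI_measurable => j _; exact: measurable_asbool.
rewrite -bigcap_seq; apply/seteqP; split => x /=.
  by move=> <- j _ /=; rewrite ffunE.
by move=> h; apply/ffunP => j; rewrite ffunE; apply: (h j); rewrite /= mem_index_enum.
Qed.

Definition cell r (x : T) : {ffun 'I_r -> bool} * bool :=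
  (trunc r (code x), `[< X x >]).

Lemma measurable_cell r o : measurable (cell r @^-1` [set o]).
Proof.
case: o => u b; rewrite (_ : _ @^-1` _ =
    (trunc r \o code) @^-1` [set u] `&` [set x | `[< X x >] = b]).
  by apply: measurableI; [exact: measurable_trunc|exact: measurable_asbool].
by apply/seteqP; split => x /=; [case|case=> <- <-].
Qed.

Definition unshattered_prob k s : R :=
  fine (power_prob P k [set t | ~~ bits_shattered s (fun i => code (tnth t i))]).

(** Every level [r >= s] computes this probability, so one finite space serves all lower levels at
    once. *)
Lemma unshattered_probE k s r : (s <= r)%N ->
  \sum_(h : {ffun 'I_k -> _}) weight (cellw P (cell r)) h *
    (~~ bits_shattered s (fun i => bits (h i).1))%:R = unshattered_prob k s.
Proof.
move=> sr; apply: EFin_inj.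
rewrite -(power_prob_cells P (@measurable_cell r)
  (fun h => ~~ bits_shattered s (fun i => bits (h i).1))).
rewrite fineK ?fin_num_measure//.
  congr (power_prob _ _ _); apply/funext => t /=; congr (is_true (~~ _)).
  by apply: eq_bits_shattered => i j js; rewrite ffunE bits_trunc// (leq_trans js).
rewrite (_ : [set _ | _] = [set t | (fun h : {ffun 'I_k -> {ffun 'I_s -> bool}} =>
    ~~ bits_shattered s (fun i => bits (h i)))
    (tuple_cell (trunc s \o code) t)]).
  apply: (@measurable_cells _ _ _ (@tuple_cell _ _ _ (trunc s \o code) k) _
    (fun h : {ffun 'I_k -> {ffun 'I_s -> bool}} => ~~ bits_shattered s (fun i =>
      bits (h i)))) => f.
  exact: (measurable_tuple_cell (@measurable_trunc s)).
apply/funext => t /=; congr (is_true (~~ _)).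
by apply: eq_bits_shattered => i j js; rewrite ffunE bits_trunc.
Qed.

Lemma unshattered_prob_ge0 k s : 0 <= unshattered_prob k s.
Proof. by rewrite /unshattered_prob fine_ge0. Qed.

Lemma unshattered_prob_diff k s r : (s <= r)%N ->
  \sum_(h : {ffun 'I_k -> _}) weight (cellw P (cell r)) h *
    (~~ bits_shattered s (fun i => bits (h i).1) &&
       bits_shattered r (fun i => bits (h i).1))%:R =
  unshattered_prob k s - unshattered_prob k r.
Proof.
move=> sr; rewrite -(unshattered_probE k sr) -(unshattered_probE k (leqnn r)) -sumrB.
apply: eq_bigr => h _; rewrite -mulrBr; congr (_ * _).
case: (boolP (bits_shattered s _)) => /= [/(bits_shattered_le sr) ->|_].
  by rewrite /= subrr.
by case: bits_shattered; rewrite /= ?subr0 ?subrr.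
Qed.

Lemma unshattered_prob_le k s r : (s <= r)%N ->
  unshattered_prob k r <= unshattered_prob k s.
Proof.
move=> sr; rewrite -subr_ge0 -unshattered_prob_diff//.
apply: sumr_ge0 => h _; rewrite mulr_ge0 ?weight_ge0// => o; exact: cellw_ge0.
Qed.

Lemma unshattered_prob_cauchy k (eta : R) : 0 < eta ->
  exists s0, forall s r, (s0 <= s)%N -> (s <= r)%N ->
    unshattered_prob k s - unshattered_prob k r <= eta.
Proof.
move=> eta0; pose V := range (unshattered_prob k).
have hV : has_inf V.
  split; first by exists (unshattered_prob k 0); exists 0%N.
  by exists 0 => _ [s _ <-]; exact: unshattered_prob_ge0.
have [_ [s0 _ <-] hs0] := inf_adherent eta0 hV.
exists s0 => s r s0s sr.
have := unshattered_prob_le k s0s.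
have : inf V <= unshattered_prob k r by apply: ge_inf; [exact: hV.2|exists r].
lra.
Qed.

End stage.

(** * A set whose tuples are almost all shattered *)

Section stage.
Context d (T : measurableType d) (R : realType) (P : probability T R).
Context (D : nat -> set T) (X : set T).
Hypothesis mD : forall j, measurable (D j).
Hypothesis mX : measurable X.
Local Notation code := (code D).
Local Notation cell := (cell D X).
Local Notation unshattered_prob := (unshattered_prob P D).

Definition bit_family r (j : 'I_r) : pred ({ffun 'I_r -> bool} * bool) :=
  fun o => o.1 j && o.2.

Lemma emp_Av r n (t : n.-tuple T) (j : 'I_r) :
  emp R (tuple_cell (cell r) t) (bit_family j) = Av R t (D j `&` X).
Proof.
rewrite /emp /Av card_ord; congr (_ / _).
rewrite -sum1_card natr_sum [RHS]big_mkcond/=.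
apply: eq_bigr => i _; rewrite ffunE /bit_family/= ffunE /code inE.
by rewrite -asbool_and -/((D j `&` X) (tnth t i)); case: asbool.
Qed.

Lemma wprob_bit_family r (j : 'I_r) :
  wprob (cellw P (cell r)) (bit_family j) = fine (P (D j `&` X)).
Proof.
rewrite (wprob_cellw _ (measurable_cell mD mX (r := r))); congr (fine (P _)).
apply/seteqP; split => x /=; rewrite /bit_family/= ffunE /code.
  by move=> /andP[/asboolP ? /asboolP].
by move=> [? ?]; apply/andP; split; apply/asboolP.
Qed.

Variable e : R.
Hypotheses (e0 : 0 < e) (e1 : e <= 1).
Hypothesis fails : forall n0, exists n r0, (n0 <= n)%N /\
  (e%:E < power_prob P n [set t | exists2 j, (j < r0)%N &
     (e < `|Av R t (D j `&` X) - fine (P (D j `&` X))|)%R])%E.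

(** The traces are those of [D j] cut by [X]. Some trace contains all the selected points, so these
    lie in [X], where the cut changes nothing. *)
Lemma shatters_bits r n (f : {ffun 'I_n * bool -> _}) (I : {set 'I_n * bool})
    k (i : 'I_k -> 'I_n * bool) :
  shatters (traces (@bit_family r) f) I ->
  injective i -> (forall l, i l \in I) ->
  bits_shattered r (fun l => bits (f (i l)).1).
Proof.
move=> /shattersP sI inji iI; apply/bits_shatteredP => S.
have cut (S' : {set 'I_k}) : exists j, forall l, bit_family j (f (i l)) = (l \in S').
  have [|_ /finset.imsetP[j _ ->] ejS] := sI (finset.imset i (mem S')).
    by apply/fintype.subsetP => _ /finset.imsetP[l _ ->].
  exists j => l; move/finset.setP/(_ (i l)) : ejS; rewrite !inE iI andbT => ->.
  by rewrite finset.mem_imset.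
(* [bits_shattered] wants the bit true exactly off [S], hence the complement. *)
have [j hj] := cut (finset.setC S).
have [j' hj'] := cut finset.setT.
exists j => // l; have := hj l; rewrite inE => <-.
have := hj' l; rewrite /bit_family inE => /andP[_ ->]; rewrite andbT.
rewrite /bits insubT// => jr; congr ((f (i l)).1 _); exact: val_inj.
Qed.

(** The sum of [2 ^+ i * shattering_tol i] over all [k <= i] is at most [e / 16]. *)
Definition shattering_tol (i : nat) : R := e / 32 / (i.+1%:R * 4 ^+ i).

Variable s : nat -> nat.
Hypothesis hs : forall i k r, (k <= i)%N -> (s i <= r)%N ->
  unshattered_prob k (s i) - unshattered_prob k r <= shattering_tol i.

(** [K] indexes the double sample, [F] gives the bits of its points and [I] is its shattered part.
    The third clause ranges over all sets of prefixes, so a union of cells costs a single error. For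
    the fourth, tuples in [I] are shattered at the full level [r], and by [hs] few tuples are
    shattered at level [r] but not yet at level [s i]. *)
Lemma exists_stage (nu : nat) :
  exists (K : finType) (F : K -> nat -> bool) (I : {set K}),
  [/\ (nu < #|K|)%N, vc_rate e * #|K|%:R <= #|I|%:R,
   forall s', (s' <= nu)%N -> forall A : {set {ffun 'I_s' -> bool}},
     \sum_k (trunc s' (F k) \in A)%:R <=
       (fine (P [set x | trunc s' (code x) \in A]) + nu.+1%:R^-1) * #|K|%:R &
   forall i k, (i <= nu)%N -> (k <= i)%N ->
     \sum_(g : {ffun 'I_k -> K}) [&& injectiveb g, [forall l, g l \in I] &
        ~~ bits_shattered (s i) (F \o g)]%:R <= 2 ^- i * #|K|%:R ^+ k :> R].
Proof.
(* [c] adds up the coefficients of the cost [Z2] below, whose expectation is then at most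
   [c / #|K|]. The summands of [n0] provide [nu < n], the sample size for [shattering_sample] and
   [16 * c / e <= n]. *)
pose c : R := \sum_(s' < nu.+1) \sum_(A : {set {ffun 'I_s' -> bool}}) nu.+1%:R ^+ 2.
have c0 : 0 <= c.
  by apply: sumr_ge0 => ? _; apply: sumr_ge0 => ? _; rewrite exprn_ge0.
pose n0 := (nu.+1 + Num.bound (512 / e ^+ 3) + Num.bound (16 * c / e))%N.
have [n [r0 [n0n gt_e]]] := fails n0.
(* Enough for the failing parameters, for prefixes of length up to [nu] and for all levels [s i]
   with [i <= nu]. *)
pose r := (r0 + nu + \sum_(i < nu.+1) s i)%N.
have r0r : (r0 <= r)%N by rewrite /r -addnA leq_addr.
have nur : (nu <= r)%N by rewrite /r addnAC leq_addl.
have sr i : (i <= nu)%N -> (s i <= r)%N.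
  move=> inu; rewrite /r (bigD1 (Ordinal (inu : (i < nu.+1)%N)))//= addnCA leq_addr//.
have n512 : 512 / e ^+ 3 <= n%:R.
  apply: le_trans (ltW (archi_boundP _)) _;
    first by rewrite divr_ge0 ?ler0n ?exprn_ge0 ?ltW.
  by rewrite ler_nat (leq_trans _ n0n)// /n0 addnAC leq_addl.
have nc : 16 * c / e <= n%:R.
  apply: le_trans (ltW (archi_boundP _)) _; first by rewrite divr_ge0 ?mulr_ge0// ltW.
  by rewrite ler_nat (leq_trans _ n0n)// /n0 leq_addl.
have nun : (nu < n)%N by rewrite (leq_trans _ n0n)// /n0 -addnA leq_addr.
have n_gt0 : (0 < n)%N by exact: leq_trans nun.
pose w := cellw P (cell r).
have w0 o : 0 <= w o by exact: cellw_ge0.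
have mcell := measurable_cell mD mX (r := r).
have w1 : \sum_o w o = 1 by exact: sum_cellw.
have : e < \sum_(f : {ffun 'I_n -> _}) weight w f *
    (deviates w (@bit_family r) e f)%:R.
  rewrite -lte_fin -(power_prob_cells P mcell (deviates w (@bit_family r) e)).
  apply: (lt_le_trans gt_e); apply: le_measure; [apply/mem_set|apply/mem_set|].
  - apply: (@measurable_Av_deviation _ _ _ _ _ (fun j => D j `&` X)
      (fun j => fine (P (D j `&` X)))) => j; exact: measurableI.
  - apply: (@measurable_cells _ _ _ (@tuple_cell _ _ _ (cell r) n) _
      (deviates w (@bit_family r) e)) => f.
    exact: (measurable_tuple_cell mcell).
  - move=> t /= [j jr h]; have jr' := leq_trans jr r0r.
    apply/existsP; exists (Ordinal jr').
    by rewrite emp_Av wprob_bit_family.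
move=> /(shattering_sample w0 w1 e0 e1 n512) large.
pose K : finType := ('I_n * bool)%type.
have K2 : #|K| = (n * 2)%N by rewrite card_prod card_ord card_bool.
have K0 : (0 < #|K|)%N by rewrite K2 muln_gt0 n_gt0.
have K0R : 0 < #|K|%:R :> R by rewrite ltr0n.
pose bad i k (h : {ffun 'I_k -> {ffun 'I_r -> bool} * bool}) :=
  ~~ bits_shattered (s i) (fun l => bits (h l).1) &&
     bits_shattered r (fun l => bits (h l).1).
(* A single sample meets all requirements because the expectation of the cost
   [Z1 + Z2] is at most [e / 8], while large shattered subsamples have
   probability at least [e / 4]. *)
pose Z1 (f : {ffun K -> {ffun 'I_r -> bool} * bool}) : R :=
  \sum_(i < nu.+1) \sum_(k < i.+1) 2 ^+ i * (#|K|%:R ^- k *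
    \sum_(g : {ffun 'I_k -> K}) (injectiveb g && bad i k [ffun l => f (g l)])%:R).
pose low s' (A : {set {ffun 'I_s' -> bool}}) (o : {ffun 'I_r -> bool} * bool) :=
  trunc s' (bits o.1) \in A.
(* The coefficients are such that [Z1 f < 1] leaves at most a fraction [2 ^- i] of bad tuples, and
   [Z2 f < 1] a frequency error of at most [1 / nu.+1]. *)
pose Z2 (f : {ffun K -> {ffun 'I_r -> bool} * bool}) : R :=
  \sum_(s' < nu.+1) \sum_(A : {set {ffun 'I_s' -> bool}})
    nu.+1%:R ^+ 2 * (emp R f (low s' A) - wprob w (low s' A)) ^+ 2.
have Z10 f : 0 <= Z1 f.
  apply: sumr_ge0 => i _; apply: sumr_ge0 => k _; rewrite mulr_ge0 ?exprn_ge0//.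
  by rewrite mulr_ge0 ?invr_ge0 ?exprn_ge0// sumr_ge0.
have Z20 f : 0 <= Z2 f.
  by apply: sumr_ge0 => i _; apply: sumr_ge0 => A _; rewrite mulr_ge0 ?sqr_ge0.
have EZ1 : \sum_f weight w f * Z1 f <= e / 16.
  apply: (@le_trans _ _ (\sum_(i < nu.+1) \sum_(k < i.+1) 2 ^+ i * shattering_tol i)).
    under eq_bigr do rewrite mulr_sumr.
    rewrite exchange_big; apply: ler_sum => i _.
    under eq_bigr do rewrite mulr_sumr.
    rewrite exchange_big; apply: ler_sum => k _.
    under eq_bigr do rewrite mulrCA [weight _ _ * _]mulrCA.
    rewrite -!mulr_sumr ler_pM2l ?exprn_gt0// ler_pdivrMl ?exprn_gt0//.
    apply: le_trans (sum_weight_inj w0 w1 K (bad i k)) _.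
    rewrite ler_pM2l ?exprn_gt0//.
    have inu : (i <= nu)%N by rewrite -ltnS.
    rewrite (unshattered_prob_diff P mD mX k (sr _ inu)).
    by apply: hs; [rewrite -ltnS|exact: sr].
  have -> : \sum_(i < nu.+1) \sum_(k < i.+1) 2 ^+ i * shattering_tol i =
      e / 32 * \sum_(i < nu.+1) 2^-1 ^+ i.
    rewrite mulr_sumr; apply: eq_bigr => i _.
    rewrite sumr_const card_ord -[LHS]mulr_natl /shattering_tol exprVn.
    have -> : 4 ^+ i = 2 ^+ i * 2 ^+ i :> R.
      by rewrite -exprMn; congr (_ ^+ _); ring.
    have x0 : 2 ^+ i != 0 :> R by rewrite expf_neq0.
    have y0 : i.+1%:R != 0 :> R by rewrite pnatr_eq0.
    move: (2 ^+ i) (i.+1%:R) x0 y0 => x y x0 y0.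
    by field; rewrite x0 y0.
  have : (1 - 2^-1) * \sum_(i < nu.+1) 2^-1 ^+ i = 1 - 2^-1 ^+ nu.+1 :> R.
    by rewrite -[RHS]opprB subrX1 -mulNr opprB.
  have : 0 <= 2^-1 ^+ nu.+1 :> R by rewrite exprn_ge0.
  move: (\sum_(i < nu.+1) _) (2^-1 ^+ nu.+1) => S q q0 hS.
  have : S <= 2 by lra.
  by rewrite -(ler_pM2l (_ : 0 < e / 32)) ?divr_gt0// => ?; lra.
have EZ2 : \sum_f weight w f * Z2 f <= e / 16.
  apply: (@le_trans _ _ (c * #|K|%:R^-1)).
    under eq_bigr do rewrite mulr_sumr.
    rewrite exchange_big /c mulr_suml; apply: ler_sum => i _.
    under eq_bigr do rewrite mulr_sumr.
    rewrite exchange_big mulr_suml; apply: ler_sum => A _.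
    under eq_bigr do rewrite mulrCA.
    rewrite -mulr_sumr ler_pM2l ?exprn_gt0//.
    exact: sum_weight_emp_dev.
  rewrite ler_pdivrMr//; move: nc; rewrite ler_pdivrMr// K2 natrM => nc.
  have : 0 <= n%:R * e by rewrite mulr_ge0// ltW.
  lra.
have [||f ls Zf] := @exists_sample _ _ w w0 K
  (large_shattered (@bit_family r) e) (fun f => Z1 f + Z2 f).
- by move=> f; rewrite addr_ge0.
- apply: (lt_le_trans _ large); under eq_bigr do rewrite mulrDr.
  rewrite big_split/=; apply: (le_lt_trans (lerD EZ1 EZ2)); move: e0; lra.
have {Zf}[Z1f Z2f] : Z1 f < 1 /\ Z2 f < 1.
  by move: Zf (Z10 f) (Z20 f) => ? ? ?; split; lra.
case/existsP : ls => I /andP[cardI shI].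
exists K, (fun k => bits (f k).1), I; split => //.
- by rewrite K2 muln2 -addnn ltn_addr.
- move=> s' s'nu A.
  have sq : (emp R f (low s' A) - wprob w (low s' A)) ^+ 2 <= nu.+1%:R ^- 2.
    rewrite -[leRHS]mulr1 -ler_pdivrMl ?invr_gt0 ?exprn_gt0// invrK.
    apply: le_trans (ltW Z2f); rewrite /Z2.
    rewrite (bigD1 (Ordinal (s'nu : (s' < nu.+1)%N)))//= (bigD1 A)//= -addrA lerDl.
    rewrite addr_ge0//; first by apply: sumr_ge0 => ? _; rewrite mulr_ge0 ?sqr_ge0.
    apply: sumr_ge0 => i _; apply: sumr_ge0 => ? _.
    by rewrite mulr_ge0 ?sqr_ge0.
  have {}sq : emp R f (low s' A) - wprob w (low s' A) <= nu.+1%:R^-1.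
    apply: le_trans (ler_norm _) _.
    rewrite -(@ler_pXn2r _ 2)// ?nnegrE ?invr_ge0//.
    by rewrite real_normK ?num_real// exprVn.
  rewrite -ler_pdivrMr//.
  have -> : fine (P [set x | trunc s' (code x) \in A]) = wprob w (low s' A).
    rewrite /w (wprob_cellw _ mcell); congr (fine (P _)).
    apply/funext => x /=; rewrite /low (_ : trunc s' (bits (cell r x).1) = trunc s'
      (code x))//.
    apply/ffunP => j; rewrite !ffunE bits_trunc//.
    exact: leq_trans (ltn_ord j) (leq_trans s'nu nur).
  by rewrite -lerBlDl.
- move=> i k inu ki.
  have : 2 ^+ i * (#|K|%:R ^- k *
    \sum_(g : {ffun 'I_k -> K}) (injectiveb g && bad i k [ffun l => f (g l)])%:R)
      <= 1 :> R.
    apply: le_trans (ltW Z1f); rewrite /Z1.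
    rewrite (bigD1 (Ordinal (inu : (i < nu.+1)%N)))//= (bigD1 (Ordinal (ki : (k <
      i.+1)%N)))//=.
    rewrite -addrA lerDl addr_ge0//.
      apply: sumr_ge0 => k' _; rewrite mulr_ge0 ?exprn_ge0//.
      by rewrite mulr_ge0 ?invr_ge0 ?exprn_ge0// sumr_ge0.
    apply: sumr_ge0 => i' _; apply: sumr_ge0 => k' _; rewrite mulr_ge0 ?exprn_ge0//.
    by rewrite mulr_ge0 ?invr_ge0 ?exprn_ge0// sumr_ge0.
  rewrite -ler_pdivlMl ?exprn_gt0// mulr1 ler_pdivrMl ?exprn_gt0// [X in _ <= X ->
    _]mulrC.
  move=> le; apply: le_trans le.
  apply: ler_sum => g _; rewrite ler_nat.
  case: injectiveP => //= injg; case: forallP => //= gI.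
  have E u : bits_shattered u (fun l => bits ([ffun l' => f (g l')] l).1) =
      bits_shattered u (fun l => bits (f (g l)).1).
    by apply: eq_bits_shattered => l j _; rewrite ffunE.
  by rewrite /bad !E (shatters_bits shI injg gI) andbT.
Qed.

End stage.

(** Birthday bound: all but a fraction k^2/N of the k-tuples from N points are injective. The factor
    [N] avoids division in [nat]. *)
Lemma expn_le_ffact N k : (N ^ k * N <= N ^_ k * N + k ^ 2 * N ^ k)%N.
Proof.
elim: k => [|k IH]; first by rewrite !expn0 ffactn0 !mul1n leq_addr.
have ffle : (N ^_ k <= N ^ k)%N.
  elim: k {IH} => [|k IH]; first by rewrite ffactn0.
  by rewrite ffactnSr expnSr leq_mul// leq_subr.
rewrite expnSr ffactnSr; apply: leq_trans (leq_mul IH (leqnn N)) _.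
have h : (N ^_ k * N * N <= N ^_ k * (N - k) * N + N ^ k * N * k)%N.
  apply: (@leq_trans (N ^_ k * ((N - k) + k) * N)%N).
    by rewrite leq_mul// leq_mul// addnC -leq_subLR.
  rewrite mulnDr mulnDl leq_add2l -!mulnA [(N * k)%N]mulnC leq_mul//.
rewrite mulnDl; apply: leq_trans (leq_add h (leqnn _)) _.
rewrite -addnA leq_add2l -(mulnA _ (N ^ k)%N) [(_ * k)%N]mulnC -mulnDl leq_mul//.
nia.
Qed.

Lemma sum_noninjective_le (R : realType) (K : finType) k :
  (\sum_(g : {ffun 'I_k -> K}) (~~ injectiveb g)%:R) * #|K|%:R <=
  (k ^ 2)%:R * #|K|%:R ^+ k :> R.
Proof.
have E : (\sum_(g : {ffun 'I_k -> K}) (~~ injectiveb g) + #|K| ^_ k = #|K| ^ k)%N.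
  have := card_inj_ffuns 'I_k K; rewrite card_ord => <-.
  transitivity #|{ffun 'I_k -> K}|; last by rewrite card_ffun card_ord.
  rewrite -!sum1_card [X in (_ + X)%N]big_mkcond -big_split/=; apply: eq_bigr => g _.
  by rewrite inE; case: injectiveb.
rewrite -natr_sum -natrX -!natrM ler_nat.
rewrite -(leq_add2r (#|K| ^_ k * #|K|)) -mulnDl E [leqRHS]addnC.
exact: expn_le_ffact.
Qed.

(** * Passage to the limit along an ultrafilter *)

Section limit.
Context d (T : measurableType d) (R : realType) (P : probability T R).
Context (D : nat -> set T) (X : set T).
Hypothesis mD : forall j, measurable (D j).
Hypothesis mX : measurable X.
Local Notation code := (code D).
Local Notation unshattered_prob := (unshattered_prob P D).

Variable e : R.
Hypotheses (e0 : 0 < e) (e1 : e <= 1).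
Hypothesis fails : forall n0, exists n r0, (n0 <= n)%N /\
  (e%:E < power_prob P n [set t | exists2 j, (j < r0)%N &
     (e < `|Av R t (D j `&` X) - fine (P (D j `&` X))|)%R])%E.

Lemma exists_levels : exists s : nat -> nat, forall i k r,
  (k <= i)%N -> (s i <= r)%N ->
  unshattered_prob k (s i) - unshattered_prob k r <= shattering_tol e i.
Proof.
suff h i : exists si, forall k r, (k <= i)%N -> (si <= r)%N ->
    unshattered_prob k si - unshattered_prob k r <= shattering_tol e i.
  by have [s hs] := choice h; exists s.
have tol0 : 0 < shattering_tol e i.
  by rewrite /shattering_tol divr_gt0 ?divr_gt0// mulr_gt0 ?ltr0n ?exprn_gt0.
have [s0 hs0] := choice (fun k => unshattered_prob_cauchy P mD mX k tol0).
exists (\sum_(k < i.+1) s0 k)%N => k r ki; apply: hs0.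
by rewrite (bigD1 (Ordinal (ki : (k < i.+1)%N)))//= leq_addr.
Qed.

Let gam : R := vc_rate e.

Let gam0 : 0 < gam.
Proof. by rewrite /gam /vc_rate exprn_gt0// divr_gt0// exprn_gt0. Qed.

Definition prefix_prob s (b : nat -> bool) : R :=
  fine (P [set x | trunc s (code x) == trunc s b]).

(** Points of [I] are counted relative to all of [K], which makes the result comparable with
    [prefix_prob] cell by cell. *)
Definition prefix_freq (K : finType) (F : K -> nat -> bool) (I : {set K})
    s (b : nat -> bool) : R :=
  (\sum_(k in I) (trunc s (F k) == trunc s b)%:R) / #|K|%:R.

Lemma trunc_bits s (u : {ffun 'I_s -> bool}) : trunc s (bits u) = u.
Proof.
apply/ffunP => j; rewrite ffunE /bits insubT => [|jr]; first exact: ltn_ord.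
by congr (u _); exact: val_inj.
Qed.

Lemma trunc_trunc s r b : (s <= r)%N -> trunc s (bits (trunc r b)) = trunc s b.
Proof.
by move=> sr; apply/ffunP => j; rewrite !ffunE bits_trunc// (leq_trans (ltn_ord j)).
Qed.

Lemma prefix_probE s (u : {ffun 'I_s -> bool}) :
  prefix_prob s (bits u) = cellw P (trunc s \o code) u.
Proof.
rewrite /prefix_prob /cellw; congr (fine (P _)); apply/funext => x /=.
by rewrite trunc_bits; apply/propext; split => [/eqP|->].
Qed.

Lemma sum_prefix_prob s (B : pred {ffun 'I_s -> bool}) :
  fine (P [set x | B (trunc s (code x))]) = \sum_(u | B u) prefix_prob s (bits u).
Proof.
rewrite (measure_cells_fin P (@measurable_trunc _ _ _ mD s)) /=.
by apply: eq_bigr => u _; rewrite prefix_probE.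
Qed.

Lemma sum_prefix_freq (K : finType) (F : K -> nat -> bool) (I : {set K})
    s (B : pred {ffun 'I_s -> bool}) :
  (\sum_(k in I) (B (trunc s (F k)))%:R) / #|K|%:R =
  \sum_(u | B u) prefix_freq F I s (bits u).
Proof.
rewrite /prefix_freq -mulr_suml exchange_big/=; congr (_ / _).
apply: eq_bigr => k _; case: (boolP (B _)) => BF.
  rewrite (bigD1 (trunc s (F k)))//= trunc_bits eqxx big1 ?addr0// => u /andP[_ ne].
  by rewrite trunc_bits eq_sym (negbTE ne).
rewrite big1// => u Bu; rewrite trunc_bits.
by have [Fu|//] := eqVneq (trunc s (F k)) u; rewrite Fu Bu in BF.
Qed.

Lemma measurable_trunc_set s (B : pred {ffun 'I_s -> bool}) :
  measurable [set x | B (trunc s (code x))].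
Proof.
exact: (@measurable_cells _ _ _ (trunc s \o code) (@measurable_trunc _ _ _ mD s) B).
Qed.

(** [Es s] keeps the prefixes all of whose initial segments are heavy at [G]-almost every stage.
    Light prefixes carry at most gamma/2 of the sample within [I], so [Es s] carries at least
    gamma/2, and the frequency bound of [exists_stage] turns this into probability. On [Es s]
    probabilities are at most 2/gamma times frequencies, so unshattered tuples there are controlled
    by those of the subsample. *)
Lemma exists_common_shattering_set :
  exists Es : forall s, pred {ffun 'I_s -> bool},
  (0 < P [set x | forall s, Es s (trunc s (code x))])%E /\
  forall k (eta : R), 0 < eta -> exists s,
    \sum_(h : {ffun 'I_k -> _}) weight (cellw P (trunc s \o code)) h *
      ([forall l, Es s (h l)] && ~~ bits_shattered s (fun l => bits (h l)))%:R
    <= eta.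
Proof.
have [s hs] := exists_levels.
have [K hK] := choice (exists_stage mD mX e0 e1 fails hs).
have [F hF] := all_tag (fun nu => cid (hK nu)).
have [I hI] := all_tag (fun nu => cid (hF nu)).
pose freq nu := prefix_freq (F nu) (I nu).
(* [G] contains the final segments, so every [G]-large set contains arbitrarily late stages. *)
have [G [UG sG]] := ultraFilterLemma (eventually_filter : ProperFilter \oo).
pose heavy nu r b := gam / 2 * prefix_prob r b <= freq nu r b.
pose ok r b : Prop := G [set nu | heavy nu r b].
pose Okl t b : Prop := forall r, (r < t)%N -> ok r b.
have heavy_trunc nu t r b : (t <= r)%N -> heavy nu t (bits (trunc r b)) = heavy nu t b.
  by move=> tr; rewrite /heavy /freq /prefix_freq /prefix_prob trunc_trunc.
have ok_trunc t r b : (t <= r)%N -> ok t (bits (trunc r b)) = ok t b.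
  by move=> tr; rewrite /ok; congr G; apply/funext => m /=; rewrite heavy_trunc.
have Okl_trunc t r b : (t <= r.+1)%N -> Okl t (bits (trunc r b)) = Okl t b.
  move=> tr; apply/propext; split => h l lt; have := h _ lt;
    by rewrite ok_trunc// -ltnS (leq_trans lt tr).
have agree1 r b : G [set nu | heavy nu r b <-> ok r b].
  case: (in_ultra_setVsetC [set nu | heavy nu r b] UG) => h.
    by apply: (filterS _ h) => nu /= h'; split => // _; exact: h.
  have nok : ~ ok r b.
    move=> /(filterI h) h2; have [x [hx /hx]] := filter_ex h2; exact.
  by apply: (filterS _ h) => nu /= h'; split => [/h'|/nok].
(* Only finitely many prefixes have length at most [r], so [G]-many stages decide all of them as the
   limit does. *)
have agree r : G [set nu | forall b t, (t <= r)%N -> heavy nu t b <-> ok t b].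
  have : G [set nu | forall (u : {ffun 'I_r -> bool}) (t : 'I_r.+1),
      heavy nu t (bits u) <-> ok t (bits u)].
    apply: (@filter_forall _ _ (fun u => [set nu | forall t : 'I_r.+1,
      heavy nu t (bits u) <-> ok t (bits u)])) => u.
    by apply: filter_forall => t; exact: agree1.
  apply: filterS => nu /= h b t tr.
  have := h (trunc r b) (Ordinal (tr : (t < r.+1)%N)) => /=.
  by rewrite heavy_trunc// ok_trunc.
have big n0 : G [set nu | (n0 <= nu)%N] by exact/sG/nbhs_infty_ge.
have N0 nu : 0 < #|K nu|%:R :> R.
  by have [h _ _ _] := hI nu; rewrite ltr0n; exact: leq_trans h.
pose light t b := ~~ `[< Okl t b >].
have mlight t r : (t <= r.+1)%N -> measurable [set x | light t (code x)].
  move=> tr; have := measurable_trunc_set (fun u : {ffun 'I_r -> bool} => light t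
    (bits u)).
  congr measurable; apply/funext => x /=; congr (is_true (~~ `[< _ >])).
  exact: Okl_trunc.
(* The prefixes outside [Okl] split into disjoint cells, taken at the first level
   where they fail to be heavy. *)
have light_mass nu r : (forall b t, (t <= r)%N -> heavy nu t b <-> ok t b) ->
    forall t, (t <= r.+1)%N ->
    (\sum_(k in I nu) (light t (F nu k))%:R) / #|K nu|%:R <=
    gam / 2 * fine (P [set x | light t (code x)]).
  move=> hnu; elim => [_|t IH tr].
    rewrite big1 ?mul0r => [|k _]; last first.
      by rewrite /light (_ : `[< _ >] = true)//; apply/asboolP.
    by rewrite mulr_ge0 ?fine_ge0// divr_ge0 ?ltW.
  pose C (v : {ffun 'I_t -> bool}) := `[< Okl t (bits v) /\ ~ ok t (bits v) >].
  have CE b : C (trunc t b) = `[< Okl t b /\ ~ ok t b >].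
    by rewrite /C Okl_trunc// ok_trunc.
  have split_light b : light t.+1 b = light t b || C (trunc t b).
    rewrite CE /light -asbool_neg -asbool_neg -asbool_or; apply: asbool_equiv_eq.
    split.
      move=> h; apply: contrapT => /not_orP[/contrapT h1 h2]; apply: h => l.
      rewrite ltnS leq_eqVlt => /predU1P[->|]; last exact: h1.
      by apply: contrapT => ?; apply: h2.
    by case=> [h h'|[h h'] h'']; [apply: h => l lt; apply: h';
      exact: leqW|apply: h'; apply: h''].
  have disj b : light t b -> C (trunc t b) -> False.
    by rewrite CE => /asboolPn h /asboolP[].
  have -> : [set x | light t.+1 (code x)] =
      [set x | light t (code x)] `|` [set x | C (trunc t (code x))].
    apply/funext => x /=; rewrite split_light; apply/propext.
    by split => [/orP|] //; move=> /orP.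
  have mC := measurable_trunc_set C.
  have ml : measurable [set x | light t (code x)] by apply: (mlight t r); exact: ltnW.
  rewrite measureU//; last first.
    by apply/seteqP; split => x // [/disj h /h].
  rewrite fineD ?fin_num_measure// mulrDr.
  rewrite (_ : \sum_(k in I nu) (light t.+1 (F nu k))%:R =
    \sum_(k in I nu) (light t (F nu k))%:R +
    \sum_(k in I nu) (C (trunc t (F nu k)))%:R); last first.
    rewrite -big_split/=; apply: eq_bigr => k _; rewrite split_light.
    case: (boolP (light _ _)) => [/disj h|_]; last by rewrite add0r.
    by case: (boolP (C _)) => [/h//|_]; rewrite addr0.
  rewrite mulrDl; apply: lerD; first by apply: IH; exact: ltnW.
  (* A cell of [C] is not [ok], hence not heavy at [nu]: its frequency is below gamma/2 times its
     probability. *)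
  rewrite sum_prefix_freq sum_prefix_prob mulr_sumr;
    apply: ler_sum => v /asboolP[_ nok].
  rewrite leNgt; apply/negP => /ltW /(hnu (bits v) t tr); exact: nok.
(* [Okl r.+1] includes level [r], so the whole prefix is heavy too; the second claim relies on
   this. *)
pose Es r : pred {ffun 'I_r -> bool} := fun u => `[< Okl r.+1 (bits u) >].
have EsE r b : Es r (trunc r b) = `[< Okl r.+1 b >] by rewrite /Es Okl_trunc.
exists Es; split.
  pose E r := [set x | Es r (trunc r (code x))].
  have mE r : measurable (E r) by exact: measurable_trunc_set.
  have -> : [set x | forall r, Es r (trunc r (code x))] = \bigcap_r E r.
    by apply/seteqP; split => [x h r _|x h r]; [exact: h|exact: (h r Logic.I)].
  have PE r : ((gam / 2)%:E <= P (E r))%E.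
    rewrite -[P _]fineK ?fin_num_measure// lee_fin.
    apply/ler_addgt0Pr => eta eta0.
    have [nu [/= [hnu rnu] etanu]] := filter_ex (filterI (filterI (agree r) (big r))
      (big (Num.bound eta^-1))).
    have [_ cardI hA _] := hI nu.
    have := light_mass _ _ hnu _ (leqnn _).
    have := hA _ rnu (finset.finset (Es r)).
    under eq_bigr do rewrite inE.
    rewrite -ler_pdivrMr//.
    have -> : [set x | trunc r (code x) \in finset.finset (Es r)] = E r.
      by apply/funext => x /=; rewrite inE.
    have etanu' : nu.+1%:R^-1 <= eta.
      rewrite -[leRHS]invrK lef_pV2 ?posrE ?invr_gt0 ?ltr0n//.
      apply: le_trans (ltW (archi_boundP _)) _; first by rewrite invr_ge0 ltW.
      by rewrite ler_nat leqW.
    (* Every point of [I nu], of proportion at least gamma, is light or has its prefix in [Es r]. *)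
    have tot : (\sum_(k in I nu) (light r.+1 (F nu k))%:R) / #|K nu|%:R +
        (\sum_k (Es r (trunc r (F nu k)))%:R) / #|K nu|%:R >= gam.
      rewrite -mulrDl ler_pdivlMr// (le_trans cardI)// -sum1_card natr_sum.
      rewrite -lerBlDl -sumrB.
      apply: (@le_trans _ _ (\sum_(k in I nu) (Es r (trunc r (F nu k)))%:R)).
        apply: ler_sum => k _; rewrite EsE /light.
        by case: asbool; rewrite /= ?subr0 ?subrr.
      by rewrite [leRHS](bigID (mem (I nu)))/= lerDl sumr_ge0.
    have : fine (P [set x | light r.+1 (code x)]) <= 1.
      by rewrite -lee_fin fineK ?fin_num_measure ?probability_le1//; exact: mlight.
    move: (fine (P [set x | light r.+1 (code x)])) => q q1.
    have {}q1 : gam / 2 * q <= gam / 2 by rewrite ler_piMr// divr_ge0// ltW.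
    move=> freq_le light_le.
    have := le_trans tot (lerD (le_trans light_le q1) (le_trans freq_le (lerD (lexx
      _) etanu'))).
    by rewrite {1}[gam]splitr lerD2l.
  have : P \o E @ \oo --> P (\bigcap_r E r).
    apply: nonincreasing_cvg_mu => //.
    - by rewrite (le_lt_trans (probability_le1 _ (mE 0%N)))// ltry.
    - exact: bigcapT_measurable.
    - apply/nonincreasing_seqP => r; apply/subsetPset => x; rewrite /E /= !EsE.
      by move=> /asboolP h; apply/asboolP => l lr; apply: h; exact: leqW.
  move=> cv; apply: (@lt_le_trans _ _ (gam / 2)%:E); first by rewrite lte_fin divr_gt0.
  rewrite -(cvg_lim _ cv)//; apply: lime_ge; first by apply/cvg_ex;
    exists (P (\bigcap_r E r)).
  by apply: nearW => r; exact: PE.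
move=> k eta eta0.
(* The price of replacing probabilities by frequencies in [k] coordinates. Half of [eta] goes to
   non-injective tuples, half to injective ones not shattered at level [s i]. *)
pose A : R := (2 / gam) ^+ k.
have A0 : 0 < A by rewrite exprn_gt0// divr_gt0.
have B0 : 0 < eta / (2 * A) by rewrite divr_gt0// mulr_gt0.
have [i0 hi0] : exists i0, 2 ^- i0 <= eta / (2 * A).
  exists (Num.bound (2 * A / eta)).
  rewrite -[leRHS]invrK lef_pV2 ?posrE ?invr_gt0 ?B0 ?exprn_gt0//.
  rewrite invf_div; apply: le_trans (ltW (archi_boundP _)) _.
    by rewrite divr_ge0 ?mulr_ge0// ltW.
  by rewrite -natrX ler_nat ltnW// ltn_expl.
(* Stages control [k]-tuples at level [s i] only for [k <= i]. *)
pose i := maxn i0 k.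
have hi : 2 ^- i <= eta / (2 * A).
  apply: le_trans hi0; rewrite lef_pV2 ?posrE ?exprn_gt0//.
  by rewrite ler_weXn2l ?ler1n// leq_maxl.
exists (s i).
have [nu [/= [hnu inu] cnu]] := filter_ex (filterI (filterI (agree (s i)) (big i))
  (big (Num.bound ((k ^ 2)%:R * (2 * A / eta))))).
have [nuK _ _ hS] := hI nu.
have k2 : (k ^ 2)%:R / #|K nu|%:R <= eta / (2 * A).
  rewrite ler_pdivrMr// mulrC -ler_pdivrMr ?B0// invf_div.
  apply: le_trans (ltW (archi_boundP _)) _.
    by rewrite mulr_ge0// divr_ge0 ?mulr_ge0// ltW.
  by rewrite ler_nat (leq_trans cnu)// ltnW.
apply: (@le_trans _ _ (A * (\sum_(h : {ffun 'I_k -> {ffun 'I_(s i) -> bool}})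
    (\prod_l freq nu (s i) (bits (h l))) *
    (~~ bits_shattered (s i) (fun l => bits (h l)))%:R))).
  rewrite mulr_sumr; apply: ler_sum => h _.
  case: (boolP [forall l, Es (s i) (h l)]) => [/forallP hE|_]; last first.
    rewrite /= mulr0; apply: mulr_ge0; first exact: ltW.
    rewrite mulr_ge0//; apply: prodr_ge0 => l _.
    by rewrite /freq /prefix_freq divr_ge0// sumr_ge0.
  rewrite /= mulrA ler_wpM2r// /weight /A -[X in _ ^+ X]card_ord -prodr_const
    -big_split/=.
  apply: ler_prod => l _; rewrite cellw_ge0/=.
  have /asboolP/(_ _ (ltnSn _)) := hE l.
  move/(hnu _ _ (leqnn _)); rewrite /heavy prefix_probE => hl.
  rewrite -(ler_pM2l (_ : 0 < gam / 2)) ?divr_gt0//; apply: (le_trans hl).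
  by rewrite mulrA (_ : gam / 2 * (2 / gam) = 1) ?mul1r//; field; rewrite gt_eqF.
(* Expanding the product of frequencies counts the maps into [I nu], grouped by the prefixes of
   their values. *)
have -> : \sum_(h : {ffun 'I_k -> {ffun 'I_(s i) -> bool}})
    (\prod_l freq nu (s i) (bits (h l))) *
    (~~ bits_shattered (s i) (fun l => bits (h l)))%:R =
    #|K nu|%:R ^- k * \sum_(g : {ffun 'I_k -> K nu})
      ([forall l, g l \in I nu] && ~~ bits_shattered (s i) (F nu \o g))%:R.
  pose tr (g : {ffun 'I_k -> K nu}) : {ffun 'I_k -> {ffun 'I_(s i) -> bool}} :=
    [ffun l => trunc (s i) (F nu (g l))].
  rewrite mulr_sumr [RHS](partition_big tr xpredT)//=; apply: eq_bigr => h _.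
  transitivity (#|K nu|%:R ^- k * (\sum_(g in family (fun l => [pred x | (x \in I nu) &&
      (trunc (s i) (F nu x) == h l)])) 1) *
      (~~ bits_shattered (s i) (fun l => bits (h l)))%:R : R).
    congr (_ * _); rewrite /freq /prefix_freq.
    under eq_bigr do rewrite trunc_bits.
    rewrite big_split/= prodr_const card_ord exprVn mulrC; congr (_ * _).
    transitivity (\prod_(l < k) \sum_(x | (x \in I nu) && (trunc (s i) (F nu x) ==
      h l)) (1 : R)).
      apply: eq_bigr => l _; rewrite [RHS]big_mkcondr/=; apply: eq_bigr => x _.
      by case: eqP.
    rewrite (bigA_distr_big_dep _ (fun _ _ => 1 : R)); apply: eq_bigr => g _.
    by rewrite big1.
  rewrite -mulrA -mulr_sumr; congr (_ * _); rewrite mulr_suml.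
  rewrite [RHS](bigID (fun g : {ffun 'I_k -> K nu} => [forall l, g l \in I nu]))/=.
  rewrite [X in _ + X]big1 ?addr0; last by move=> g /andP[_ /negbTE ->].
  apply: eq_big => [g|g /familyP gh].
    apply/familyP/andP => [gh|[/eqP gh /forallP gI] l].
      split; last by apply/forallP => l; have := gh l; rewrite inE => /andP[].
      by apply/eqP/ffunP => l; rewrite ffunE; have := gh l;
        rewrite inE => /andP[_ /eqP].
    by rewrite inE gI/= -gh ffunE.
  rewrite mul1r; have -> : [forall l, g l \in I nu].
    by apply/forallP => l; have := gh l; rewrite inE => /andP[].
  rewrite /=; congr ((~~ _)%:R); apply: eq_bits_shattered => l j js.
  by have := gh l; rewrite inE => /andP[_ /eqP <-]; rewrite bits_trunc.
have SB : \sum_(g : {ffun 'I_k -> K nu})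
      ([forall l, g l \in I nu] && ~~ bits_shattered (s i) (F nu \o g))%:R <=
    ((k ^ 2)%:R / #|K nu|%:R + 2 ^- i) * #|K nu|%:R ^+ k :> R.
  apply: (@le_trans _ _ (\sum_(g : {ffun 'I_k -> K nu}) ((~~ injectiveb g)%:R +
     [&& injectiveb g, [forall l, g l \in I nu] &
        ~~ bits_shattered (s i) (F nu \o g)]%:R))).
    apply: ler_sum => g _; case: injectiveb; first by rewrite add0r.
    by rewrite addr0 ler_nat; case: (_ && _).
  rewrite big_split/= mulrDl; apply: lerD; last by apply: hS => //; exact: leq_maxr.
  by rewrite mulrAC ler_pdivlMr// sum_noninjective_le.
apply: (@le_trans _ _ (A * ((k ^ 2)%:R / #|K nu|%:R + 2 ^- i))).
  rewrite ler_pM2l// ler_pdivrMl ?exprn_gt0//.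
  by rewrite [leRHS]mulrC.
apply: (@le_trans _ _ (A * (eta / (2 * A) + eta / (2 * A)))).
  by rewrite ler_pM2l// lerD.
rewrite le_eqVlt; apply/orP; left; apply/eqP; move: A0; move: (A) => A' A'0.
by field; rewrite gt_eqF.
Qed.

End limit.

Local Open Scope measure_scope.

(** * Uniform law over finite families of parameters *)

Section shattered_tuples.
Context d (T : measurableType d) (R : realType) (Q : probability T R).
Context (D : nat -> set T).
Hypothesis mD : forall j, measurable (D j).
Context (Es : forall s, pred {ffun 'I_s -> bool}).
Hypothesis hEs : forall k (eta : R), 0 < eta -> exists s,
    \sum_(h : {ffun 'I_k -> _}) weight (cellw Q (trunc s \o code D)) h *
      ([forall l, Es (h l)] && ~~ bits_shattered s (fun l => bits (h l)))%:R
    <= eta.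

Definition selected : set T := [set x | forall s, Es (trunc s (code D x))].

Lemma measurable_selected : measurable selected.
Proof.
rewrite (_ : selected = \bigcap_s [set x | Es (trunc s (code D x))]).
  by apply: bigcapT_measurable => s; exact: measurable_trunc_set.
by apply/seteqP; split => x h s; [move=> _; exact: h|exact: (h s Logic.I)].
Qed.

Definition shattered_tuples k : set (k.-tuple T) :=
  \bigcup_s [set t | bits_shattered s (fun i => code D (tnth t i))].

Lemma measurable_shattered_tuples k : measurable (@shattered_tuples k).
Proof.
apply: bigcupT_measurable => s.
rewrite (_ : mkset _ = [set t | (fun h : {ffun 'I_k -> {ffun 'I_s -> bool}} =>
    bits_shattered s (fun i => bits (h i)))
    (tuple_cell (trunc s \o code D) t)]).
  apply: (@measurable_cells _ _ _ (@tuple_cell _ _ _ (trunc s \o code D) k) _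
    (fun h : {ffun 'I_k -> {ffun 'I_s -> bool}} => bits_shattered s (fun i => bits
      (h i)))) => f.
  exact: (measurable_tuple_cell (@measurable_trunc _ _ _ mD s)).
apply/funext => t /=; congr is_true.
by apply: eq_bits_shattered => i j js; rewrite ffunE bits_trunc.
Qed.

Lemma measurable_selected_box k :
  measurable [set t : k.-tuple T | forall i, selected (tnth t i)].
Proof.
by apply: (@measurable_tuple_box _ _ _ (fun=> selected)) => _;
  exact: measurable_selected.
Qed.

(** For each [eta] the event lies in one of a finite level [s]: selected points have prefixes in
    [Es], and a tuple shattered at no level is not shattered at level [s]. *)
Lemma unshattered_selected k : power_prob Q k
  ([set t : k.-tuple T | forall i, selected (tnth t i)] `\` @shattered_tuples k) = 0%E.
Proof.
apply/eqP; rewrite eq_le measure_ge0 andbT; apply/lee_addgt0Pr => eta eta0.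
have [s] := hEs k eta0; rewrite add0e -lee_fin; apply: le_trans.
rewrite -(power_prob_cells Q (@measurable_trunc _ _ _ mD s) (fun h : {ffun 'I_k -> _} =>
   [forall l, Es (h l)] && ~~ bits_shattered s (fun l => bits (h l)))).
apply: le_measure; rewrite ?inE.
- by apply: measurableD; [exact: measurable_selected_box|exact:
    measurable_shattered_tuples].
- apply: (@measurable_cells _ _ _ (@tuple_cell _ _ _ (trunc s \o code D) k) _
    (fun h : {ffun 'I_k -> _} =>
      [forall l, Es (h l)] && ~~ bits_shattered s (fun l => bits (h l)))) => f.
  exact: (measurable_tuple_cell (@measurable_trunc _ _ _ mD s)).
- move=> t [/= tE nsh]; apply/andP; split.
    by apply/forallP => l; rewrite ffunE; exact: tE.
  apply/negP => sh; apply: nsh; exists s => //=; move: sh.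
  by rewrite (@eq_bits_shattered _ _ _ (fun i => code D (tnth t i)))// => i j js;
    rewrite ffunE bits_trunc.
Qed.

(** The tuples shattered by all parameters need not form a set of the product
    sigma-algebra; they are squeezed between those shattered by the countable
    family [D], which have full measure, and the whole power. *)
Lemma shattered_tuples_between k (S : set (k.-tuple T)) :
  S `<=` [set t | forall i, selected (tnth t i)] ->
  [set t | forall i, selected (tnth t i)] `&` @shattered_tuples k `<=` S ->
  completed_algebra_gen (power_prob Q k) S /\
  (power_prob Q k)^* S = (Q^* selected ^+ k)%E.
Proof.
set B := [set t : k.-tuple T | _]; set V := B `&` _ => SB VS.
have mB : measurable B := @measurable_selected_box k.
have mV : measurable V := measurableI _ _ mB (@measurable_shattered_tuples k).
have BV : B `\` @shattered_tuples k = B `\` V.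
  by apply/seteqP; split => t [Bt nt]; split => // h; apply: nt; [case: h|split].
have BV0 : power_prob Q k (B `\` V) = 0%E.
  by rewrite -BV; exact: unshattered_selected.
split.
  exists V => //; exists (S `\` V); last exact: setDUK.
  exists (B `\` V); split; first exact: measurableD.
    exact: BV0.
  by move=> t [/SB ? ?].
have EB : power_prob Q k B = (Q^* selected ^+ k)%E.
  rewrite (measurable_mu_extE Q measurable_selected).
  rewrite (@power_prob_box _ _ _ Q k (fun=> selected)); last by move=> _;
    exact: measurable_selected.
  rewrite /= (eq_bigr (fun=> (fine (Q selected))%:E)); last first.
    by move=> i _; rewrite fineK ?fin_num_measure//; exact: measurable_selected.
  rewrite prodEFin prodr_const card_ord EFin_expe fineK ?fin_num_measure//.
  exact: measurable_selected.
have EV : power_prob Q k V = power_prob Q k B.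
  transitivity (power_prob Q k V + power_prob Q k (B `\` V))%E.
    by rewrite BV0 adde0.
  rewrite -measureU//; last by apply/seteqP; split => t // [? []].
    by congr (power_prob _ _ _); apply: setDUK => t [].
  exact: measurableD.
apply/eqP; rewrite eq_le -EB; apply/andP; split.
  by rewrite -[leRHS]measurable_mu_extE//; exact: le_mu_ext.
by rewrite -EV -[leLHS]measurable_mu_extE//; exact: le_mu_ext.
Qed.

End shattered_tuples.


(** * The contradiction with dependence *)

Section uniform_law.
Context (R : realType) (L : language) (U : structure L) (M : set U) (p q : nat)
    (phi : formula L (p + q))
    (mu : probability (borel (stype p [set: U])) R).
Local Notation MU := (fml_over_sub p (subsetT M)).
Local Notation muM := (measure_restrict MU mu).
Local Notation Dphi b :=
  (clopen_of (fml_over p [set: U]) (PFml phi b) : set (borel (stype p [set: U]))).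

Lemma measurable_clopen (E : fragment U p) psi : fragment_set E psi ->
  measurable (clopen_of E psi : set (borel (tspace E))).
Proof. by move=> Epsi; apply: sub_sigma_algebra; exact: open_clopen_of. Qed.

Lemma measurable_Dphi (b : 'I_q -> U) :
  measurable (Dphi b).
Proof. exact: measurable_clopen. Qed.

Hypothesis dep : dependent muM.

(** Dependence is applied with both parameter sets equal to [M], and [E] is what [Es] selects among
    the phi-types over [M]. As the [b j] lie in [M], a global type and its phi-type have the same
    code, so the hypotheses carry over to the pushforward. *)
Lemma dependent_not_shattered (b : nat -> 'I_q -> U)
    (Es : forall s, pred {ffun 'I_s -> bool}) :
  (forall j l, M (b j l)) ->
  (0 < mu [set x | forall s, Es s (trunc s (code (fun j => Dphi (b j)) x))])%E ->
  (forall k (eta : R), 0 < eta -> exists s,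
    \sum_(h : {ffun 'I_k -> _})
      weight (cellw mu (trunc s \o code (fun j => Dphi (b j)))) h *
      ([forall l, Es s (h l)] && ~~ bits_shattered s (fun l => bits (h l)))%:R
    <= eta) -> False.
Proof.
move=> Mb pos hEs.
apply: (@dep M M (@subset_refl _ M) (@subset_refl _ M) q phi).
pose nuphi := measure_restrict (phi_instances_sub M phi)
  (measure_restrict (fml_over_sub p (@subset_refl _ M)) muM).
pose D' j : set (borel (sphi M phi)) :=
  clopen_of (phi_instances M phi) (PFml phi (b j)).
have mD' j : measurable (D' j).
  by apply: measurable_clopen; exists (b j) => //; left.
pose res (x : borel (stype p [set: U])) : borel (sphi M phi) :=
  brestrict (phi_instances_sub M phi)
    (brestrict (fml_over_sub p (@subset_refl _ M)) (brestrict MU x)).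
have resE x : code D' (res x) = code (fun j => Dphi (b j)) x.
  apply/funext => j; apply: asbool_equiv_eq; rewrite /D' /clopen_of /in_type /=.
  split => [[[[]]]//|h]; split; last by exists (b j) => //; left.
  by split; [split => // l; exact: Mb|move=> l; exact: Mb].
have nuE A : nuphi A = mu (res @^-1` A) by [].
have hEs' k (eta : R) : 0 < eta -> exists s,
    \sum_(h : {ffun 'I_k -> _}) weight (cellw nuphi (trunc s \o code D')) h *
      ([forall l, Es s (h l)] && ~~ bits_shattered s (fun l => bits (h l)))%:R
    <= eta.
  move=> /(hEs k)[s hs]; exists s; apply: le_trans hs.
  rewrite le_eqVlt; apply/orP; left; apply/eqP; apply: eq_bigr => h _; congr (_ * _).
  apply: eq_bigr => l _; rewrite /cellw nuE; congr (fine (mu _)).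
  by apply/funext => x /=; rewrite resE.
rewrite -/nuphi; exists (selected D' Es); split.
- exists (selected D' Es); first exact: measurable_selected.
  by exists set0; [exists set0; split|rewrite setU0].
- rewrite measurable_mu_extE; last exact: measurable_selected.
  change (0 < mu (res @^-1` selected D' Es))%E; congr (_ < mu _)%E: pos.
  by apply/funext => x /=; rewrite /selected /= resE.
move=> k k0.
apply: (shattered_tuples_between mD' hEs').
  by move=> t [].
move=> t [tE [s _ /= /bits_shatteredP sh]]; split => // I.
have [j js hj] := sh I; exists (b j) => // i.
rewrite -hj /code; by split => [?|/asboolP]; first exact/asboolP.
Qed.

(** Failures for different [n0] involve different finite lists of parameters; merged into one
    sequence, they give the limit argument a single countable family. *)
Lemma uniform_law (X : set (borel (stype p [set: U]))) (e : R) :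
  measurable X -> 0 < e -> e <= 1 ->
  exists n0, forall n, (n0 <= n)%N -> forall r (b : nat -> 'I_q -> U),
    (forall j l, M (b j l)) ->
  (power_prob mu n [set t | exists2 j, (j < r)%N &
     (e < `|Av R t (Dphi (b j) `&` X) - fine (mu (Dphi (b j) `&` X))|)%R] <= e%:E)%E.
Proof.
move=> mX e0 e1; apply: contrapT => /forallNP h.
have {}h n0 : exists nrb : nat * nat * (nat -> 'I_q -> U),
    [/\ (n0 <= nrb.1.1)%N, (forall j l, M (nrb.2 j l)) &
    (e%:E < power_prob mu nrb.1.1 [set t | exists2 j, (j < nrb.1.2)%N &
     (e < `|Av R t (Dphi (nrb.2 j) `&` X) - fine (mu (Dphi (nrb.2 j) `&` X))|)%R])%E].
  have /existsNP[n /not_implyP[n0n /existsNP[r /existsNP[b /not_implyP[Mb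
    /negP]]]]] := h n0.
  by rewrite -ltNge => ?; exists (n, r, b).
have [nrb hnrb] := choice h.
(* Entry [j] of the list for [n0] sits at index [pickle (n0, j)]; indices coding no pair get another
   tuple from [M]. *)
pose b m := if (unpickle m : option (nat * nat)) is Some ij then (nrb ij.1).2 ij.2
  else (nrb 0%N).2 0%N.
have Mb j l : M (b j l).
  by rewrite /b; case: unpickle => [ij|]; [have [] := hnrb ij.1|have [] := hnrb 0%N].
have bE i j : b (pickle (i, j)) = (nrb i).2 j by rewrite /b pickleK.
have mD j : measurable (Dphi (b j)).
  exact: measurable_Dphi.
have fails n0 : exists n r0, (n0 <= n)%N /\
  (e%:E < power_prob mu n [set t | exists2 j, (j < r0)%N &
     (e < `|Av R t (Dphi (b j) `&` X) - fine (mu (Dphi (b j) `&` X))|)%R])%E.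
  have [n0n _ lt] := hnrb n0.
  exists (nrb n0).1.1, (\sum_(j < (nrb n0).1.2) (pickle (n0, val j)).+1)%N; split => //.
  have mset (r : nat) (c : nat -> 'I_q -> U) n : measurable
     [set t : n.-tuple (borel (stype p [set: U])) | exists2 j, (j < r)%N &
     (e < `|Av R t (Dphi (c j) `&` X) - fine (mu (Dphi (c j) `&` X))|)%R].
    apply: (@measurable_Av_deviation _ _ _ _ _ (fun j => Dphi (c j) `&` X)
      (fun j => fine (mu (Dphi (c j) `&` X)))) => j.
    by apply: measurableI => //; exact: measurable_Dphi.
  apply: (lt_le_trans lt); apply: le_measure; rewrite ?inE; [exact: mset|exact: mset|].
  move=> t /= [j jr hj]; exists (pickle (n0, j)); last by rewrite bE.
  by rewrite (bigD1 (Ordinal jr))//= leq_addr.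
have [Es [pos hEs]] := exists_common_shattering_set mD mX e0 e1 fails.
exact: (dependent_not_shattered Mb pos hEs).
Qed.

End uniform_law.

(** * Compactness *)

Lemma measure_bigsetU_le d (T : measurableType d) (R : realType)
    (mu : {measure set T -> \bar R}) (I : Type) (r : seq I) (F : I -> set T) :
  (forall i, measurable (F i)) ->
  (mu (\big[setU/set0]_(i <- r) F i) <= \sum_(i <- r) mu (F i))%E.
Proof.
move=> mF; elim: r => [|i r IH]; first by rewrite !big_nil measure0.
rewrite !big_cons; apply: le_trans (leeD (lexx _) IH).
by apply: measureU2 => //; exact: bigsetU_measurable.
Qed.

(** * Inner regularity of the product measure *)

Section inner_regularity.
Context (R : realType) (T : ptopologicalType) (P : probability (borel T) R).
Hypothesis hT : hausdorff_space T.
Hypothesis regP : regular_measure P.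
Context (n : nat).

(** Tuples carry the sigma-algebra, functions on ['I_n] the topology. *)
Definition points (H : set (n.-tuple (borel T))) :
    set (prod_topology (fun _ : 'I_n => T)) :=
  [set f | H [tuple f i | i < n]].

(** Measurability is asked besides closedness because a closed set of tuples need not belong to the
    product sigma-algebra. *)
Definition inner_closed (H : set (n.-tuple (borel T))) :=
  forall eta : R, 0 < eta -> exists K : set (n.-tuple (borel T)),
    [/\ K `<=` H, measurable K, closed (points K) &
        (power_prob P n (H `\` K) <= eta%:E)%E].

Lemma regular_compact (A : set (borel T)) (eta : R) : measurable A -> 0 < eta ->
  exists K : set T, [/\ compact K, K `<=` A, measurable (K : set (borel T)) &
    (P (A `\` K) <= eta%:E)%E].
Proof.
move=> mA eta0; have [_ Psup] := regP mA.
have PA : P A \is a fin_num by rewrite fin_num_measure.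
have := Psup; move/esym => Psup'.
have [_ [K [cK KA] <-]] := ub_ereal_sup_adherent eta0 (etrans (congr1 _ Psup') PA).
rewrite Psup' => lt.
have mK : measurable (K : set (borel T)).
  rewrite -[K]setCK; apply: measurableC; apply: sub_sigma_algebra.
  exact: closed_openC (compact_closed hT cK).
exists K; split => //.
rewrite measureD//=; last by rewrite (le_lt_trans (probability_le1 _ mA))// ltry.
rewrite (setIidr KA); rewrite leeBlDr ?fin_num_measure// addeC.
by rewrite -leeBlDr ?ltW// .
Qed.

Lemma power_prob_coord (i : 'I_n) (A : set (borel T)) : measurable A ->
  power_prob P n [set t | A (tnth t i)] = P A.
Proof.
move=> mA.
rewrite (_ : mkset _ = [set t | forall j, (if j == i then A else setT) (tnth t j)]).
  rewrite (@power_prob_box _ _ _ P n (fun j => if j == i then A else setT)); last first.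
    by move=> j; case: eqP.
  rewrite (bigD1 i)//= eqxx big1 ?mule1// => j /negbTE ->.
  exact: probability_setT.
apply/seteqP; split => t /=; last by move/(_ i); rewrite eqxx.
by move=> At j; case: eqP => // ->.
Qed.

Lemma measurable_coord (i : 'I_n) (A : set (borel T)) : measurable A ->
  measurable [set t : n.-tuple (borel T) | A (tnth t i)].
Proof.
by move=> mA; rewrite -[X in measurable X]setTI; exact: measurable_tnth.
Qed.

Lemma closed_coord (i : 'I_n) (C : set T) : closed C ->
  closed ([set f | C (f i)] : set (prod_topology (fun _ : 'I_n => T))).
Proof.
move=> cC; apply: (@preimage_closed _ _ (fun f : prod_topology (fun _ : 'I_n => T)
  => f i)) => //.
by move=> f _; exact: (@proj_continuous _ (fun _ : 'I_n => T) i).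
Qed.

Lemma inner_closed_coord (i : 'I_n) (A : set (borel T)) : measurable A ->
  inner_closed [set t | A (tnth t i)].
Proof.
move=> mA eta eta0; have [K [cK KA mK PK]] := regular_compact mA eta0.
exists [set t | (K : set (borel T)) (tnth t i)]; split.
- by move=> t /= /KA.
- exact: measurable_coord.
- rewrite /points (_ : mkset _ = [set f | K (f i)]).
    by apply: closed_coord; exact: compact_closed.
  by apply/seteqP; split => f /=; rewrite tnth_mktuple.
- by move: PK; rewrite -(power_prob_coord i (measurableD mA mK)).
Qed.

Lemma inner_closed_bigcap (H : nat -> set (n.-tuple (borel T))) :
  (forall i, measurable (H i)) -> (forall i, inner_closed (H i)) ->
  inner_closed (\bigcap_i H i).
Proof.
move=> mH iH eta eta0.
have eta_gt0 i : 0 < eta / (2 ^ i.+1)%:R by rewrite divr_gt0// ltr0n expn_gt0.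
have [K hK] := choice (fun i => iH i _ (eta_gt0 i)).
exists (\bigcap_i K i); split.
- by move=> t Kt i _; have [+ _ _ _] := hK i; apply; exact: Kt.
- by apply: bigcapT_measurable => i; have [] := hK i.
- rewrite (_ : points _ = \bigcap_i points (K i)); last by apply/seteqP;
    split => f h i Ii; exact: h.
  by apply: closed_bigI => i _; have [] := hK i.
- have mHK i : measurable (H i `\` K i) by apply: measurableD => //; have [] := hK i.
  apply: (@le_trans _ _ (\sum_(i <oo) power_prob P n (H i `\` K i))%E).
    apply: measure_sigma_subadditive => //.
      apply: measurableD; first exact: bigcapT_measurable.
      by apply: bigcapT_measurable => i; have [] := hK i.
    move=> t [Ht nK]; apply: contrapT => h; apply: nK => i _.
    by apply: contrapT => nKi; apply: h; exists i => //; split => //; exact: Ht.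
  apply: le_trans (epsilon_trick0 xpredT (ltW eta0)).
  by apply: lee_nneseries => // i _; have [] := hK i.
Qed.

(** Infinite unions of closed sets need not be closed: half of [eta] pays for stopping the union at
    [N], the other half is shared by the [N.+1] approximations. *)
Lemma inner_closed_bigcup (H : nat -> set (n.-tuple (borel T))) :
  (forall i, measurable (H i)) -> (forall i, inner_closed (H i)) ->
  inner_closed (\bigcup_i H i).
Proof.
move=> mH iH eta eta0.
pose F N := \big[setU/set0]_(i < N.+1) H i.
have mF N : measurable (F N) by exact: bigsetU_measurable.
have mU : measurable (\bigcup_i H i) by exact: bigcupT_measurable.
have FU : \bigcup_N F N = \bigcup_i H i by exact: bigcup_bigsetU_bigcup.
have [N hN] : exists N, (power_prob P n ((\bigcup_i H i) `\` F N) <= (eta / 2)%:E)%E.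
  have : power_prob P n \o F @ \oo --> power_prob P n (\bigcup_N F N).
    apply: nondecreasing_cvg_mu => //; first by rewrite FU.
    by move=> N N' NN'; apply/subsetPset; exact: (@subset_bigsetU _ H N.+1 N'.+1).
  rewrite FU -[X in _ --> X](fineK (fin_num_measure (power_prob P n) _ mU)) =>
    /fine_cvgP[_] /cvgrPdist_le /(_ (eta / 2)) h.
  have [N _ /(_ N (leqnn _)) /=] := h (divr_gt0 eta0 (ltr0Sn _ 1)).
  move=> hN; exists N.
  rewrite measureD//; last by rewrite (le_lt_trans (probability_le1 _ mU))// ltry.
  rewrite setIidr; last by rewrite -FU; exact: bigcup_sup.
  rewrite -[X in (X - _)%E]fineK ?fin_num_measure// -[X in (_ - X)%E]fineK
    ?fin_num_measure//.
  by rewrite -EFinB lee_fin (le_trans (ler_norm _)).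
have eN : 0 < eta / 2 / N.+1%:R by rewrite !divr_gt0.
have [K hK] := choice (fun i => iH i _ eN).
have mK i : measurable (K i) by have [] := hK i.
exists (\big[setU/set0]_(i < N.+1) K i); split.
- rewrite -bigcup_mkord => t [i _ Kt]; exists i => //.
  by have [+ _ _ _] := hK i; apply.
- exact: bigsetU_measurable.
- rewrite (_ : points _ = \big[setU/set0]_(i < N.+1) points (K i)).
    by apply: closed_bigsetU => i _; have [] := hK i.
  rewrite -(bigcup_mkord _ K) -(bigcup_mkord _ (fun i => points (K i))).
  by apply/seteqP; split => f; rewrite /points /=; case=> i iN Ki; exists i.
- apply: (@le_trans _ _ (power_prob P n (((\bigcup_i H i) `\` F N) `|`
     \big[setU/set0]_(i < N.+1) (H i `\` K i)))).
    apply: le_measure; rewrite ?inE.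
    + by apply: measurableD => //; exact: bigsetU_measurable.
    + apply: measurableU; first exact: measurableD.
      by apply: bigsetU_measurable => i _; exact: measurableD.
    + rewrite /F -(bigcup_mkord _ H) -(bigcup_mkord _ K) -(bigcup_mkord _ (fun i =>
        H i `\` K i)) => t [Ht nK].
      case: (pselect ((\bigcup_(i in `I_N.+1) H i) t)) => [[i iN Hi]|]; last by left.
      by right; exists i => //; split => // Ki; apply: nK; exists i.
  apply: le_trans (measureU2 _ _ _) _; first exact: measurableD.
    by apply: bigsetU_measurable => i _; exact: measurableD.
  rewrite [eta]splitr EFinD; apply: leeD => //.
  apply: le_trans (measure_bigsetU_le _ _ _) _; first by move=> i; exact: measurableD.
  apply: (@le_trans _ _ (\sum_(i < N.+1) (eta / 2 / N.+1%:R)%:E)%E).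
    by apply: lee_sum => i _; have [] := hK i.
  rewrite sumEFin lee_fin sumr_const card_ord -[leLHS]mulr_natr divfK ?pnatr_eq0//.
Qed.

(** The sets approximable together with their complements form a sigma-algebra, and regularity of
    [P] puts the coordinate sets into it. *)
Lemma inner_closed_measurable (H : set (n.-tuple (borel T))) :
  measurable H -> inner_closed H.
Proof.
suff : measurable `<=` [set H : set (n.-tuple (borel T)) |
    [/\ measurable H, inner_closed H & inner_closed (~` H)]].
  by move=> h /h[].
apply: smallest_sub; first split.
- split => //; rewrite ?setC0.
    move=> eta eta0; exists set0; split => //; first exact: closed0.
    by rewrite setD0 measure0 lee_fin ltW.
  move=> eta eta0; exists setT; split => //.
  by rewrite setDv measure0 lee_fin ltW.
- move=> A [mA iA iA']; rewrite setTD; split => //; first exact: measurableC.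
  by rewrite setCK.
- move=> A hA; have mA i : measurable (A i) by have [] := hA i.
  split; first exact: bigcupT_measurable.
    by apply: inner_closed_bigcup => // i; have [] := hA i.
  rewrite setC_bigcup; apply: inner_closed_bigcap => i; first exact: measurableC.
  by have [] := hA i.
rewrite -bigcup_seq => A [i _ [B mB <-]]; rewrite setTI; split.
- exact: measurable_coord.
- exact: inner_closed_coord.
- exact: (inner_closed_coord i (measurableC mB)).
Qed.

End inner_regularity.

(** * Reduction to finitely many parameters *)

Section compactness.
Context (R : realType) (T : ptopologicalType) (P : probability (borel T) R).
Hypothesis hT : hausdorff_space T.
Hypothesis regP : regular_measure P.
Context (n : nat).
Local Notation TF := (prod_topology (fun _ : 'I_n => T)).

(** If no finite [D] sufficed, the closed sets [g j] would have the finite intersection property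
    within the compact set [points K]; a common point would be a tuple of [H] good for all [j]. *)
Lemma finite_subcover (J : choiceType) (good : J -> set (n.-tuple (borel T)))
    (g : J -> set TF) (F : set T) (H : set (n.-tuple (borel T))) (delta : R) :
  compact F -> (forall j, closed (g j)) ->
  (forall j (f : TF), (forall i, F (f i)) -> points (good j) f <-> g j f) ->
  measurable H -> (forall t, H t -> forall i, F (tnth t i)) ->
  (forall t, H t -> ~ forall j, good j t) ->
  (delta%:E < power_prob P n H)%E ->
  exists (D : seq J) (K : set (n.-tuple (borel T))),
    [/\ measurable K, K `<=` H, (delta%:E < power_prob P n K)%E &
        forall t, K t -> exists2 j, j \in D & ~ good j t].
Proof.
move=> cF cg gE mH HF ngood dH.
pose eta := (fine (power_prob P n H) - delta) / 2.
have PH : power_prob P n H = (fine (power_prob P n H))%:E.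
  by rewrite fineK ?fin_num_measure.
have eta0 : 0 < eta by rewrite divr_gt0// subr_gt0 -lte_fin -PH.
have [K [KH mK cK PK]] := inner_closed_measurable hT regP mH eta0.
have dK : (delta%:E < power_prob P n K)%E.
  have : (power_prob P n H <= power_prob P n K + power_prob P n (H `\` K))%E.
    rewrite -[X in (power_prob P n X <= _)%E](setDUK KH).
    by apply: measureU2 => //; exact: measurableD.
  have PKE : power_prob P n K = (fine (power_prob P n K))%:E.
    by rewrite fineK ?fin_num_measure.
  move=> h; have := le_trans h (leeD (lexx _) PK).
  rewrite PH PKE -EFinD lee_fin lte_fin; move: eta0; rewrite /eta.
  by move: (fine _) (fine _) => a b; lra.
suff [D hD] : exists D : seq J, forall t, K t -> exists2 j, j \in D & ~ good j t.
  by exists D, K.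
(* For empty [J] all tuples are good, so [K] is empty. Otherwise [j0] ensures that the filter below
   contains [points K]. *)
have [[j0 _]|nJ] := pselect (exists j : J, True); last first.
  exists [::] => t /KH /ngood h; exfalso; apply: h => j.
  by exfalso; apply: nJ; exists j.
apply: contrapT => /forallNP nD.
have cA : compact (points K).
  rewrite (_ : points K = points K `&` [set f : TF | forall i, F (f i)]).
    rewrite setIC; apply: compact_closedI => //.
    exact: (@tychonoff _ (fun _ : 'I_n => T) (fun=> F) (fun=> cF)).
  apply/seteqP; split => f; last by case.
  by move=> Kf; split => // i; have := HF _ (KH _ Kf) i; rewrite tnth_mktuple.
have KF (f : TF) : points K f -> forall i, F (f i).
  by move=> Kf i; have := HF _ (KH _ Kf) i; rewrite tnth_mktuple.
pose fam (j : J) := points K `&` g j.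
have fI : finI setT fam.
  move=> D _; have /existsNP[t /not_implyP[Kt nt]] := nD (j0 :: finmap.enum_fset D).
  exists (fun i => tnth t i) => j jD.
  have Kt' : points K (fun i => tnth t i) by rewrite /points /= -[X in K X](_ : t =
    _)//;
    apply: eq_from_tnth => i; rewrite tnth_mktuple.
  split => //; apply/gE; first exact: KF.
  apply: contrapT => ng; apply: nt; exists j; first by rewrite inE jD orbT.
  move=> gt; apply: ng; rewrite /points /= -[X in good j X](_ : t = _)//.
  by apply: eq_from_tnth => i; rewrite tnth_mktuple.
have [|f [Kf cl]] := cA _ (finI_filter fI).
  exists (fam j0); first exact: finI_from1.
  by move=> ? [].
apply: (ngood _ (KH _ Kf)) => j.
have cfam : closed (fam j) by exact: closedI.
have [_ /(gE j f (KF f Kf))//] : fam j f.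
apply: cfam => B fB; apply: cl => //.
by exists (fam j) => //; exact: finI_from1.
Qed.

(** [C k] and [C' k] are compact parts of [A k] and of the complement of [A k] and [Z k] together.
    On [F], which they cover for each [k], [A k] is relatively clopen, and the null set [Z k] has no
    point outside [A k]. *)
Lemma compact_decision (m : nat) (A Z : 'I_m -> set (borel T)) (eta : R) :
  (forall k, measurable (A k)) -> (forall k, measurable (Z k)) ->
  (forall k, P (Z k) = 0%E) -> 0 < eta ->
  exists (F : set T) (C C' : 'I_m -> set T),
    [/\ compact F, measurable (F : set (borel T)), (P (~` F) <= eta%:E)%E,
        forall k, closed (C k) /\ closed (C' k) &
        forall k x, F x -> [/\ C k x <-> A k x, C' k x <-> ~ A k x & Z k x -> A k x]].
Proof.
move=> mA mZ Z0 eta0.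
(* One share for [K0] and two for each [k]. *)
pose eta' := eta / (m.*2.+1)%:R.
have eta'0 : 0 < eta' by rewrite divr_gt0.
have [K0 [cK0 _ mK0 PK0]] := regular_compact hT regP measurableT eta'0.
have [C hC] := choice (fun k => regular_compact hT regP (mA k) eta'0).
pose B k := ~` (A k `|` Z k).
have mB k : measurable (B k) by apply: measurableC; exact: measurableU.
have [C' hC'] := choice (fun k => regular_compact hT regP (mB k) eta'0).
have cC k : closed (C k) by have [h _ _ _] := hC k; exact: compact_closed.
have cC' k : closed (C' k) by have [h _ _ _] := hC' k; exact: compact_closed.
have mC k : measurable (C k : set (borel T)) by have [] := hC k.
have mC' k : measurable (C' k : set (borel T)) by have [] := hC' k.
pose V := \big[setI/setT]_(k < m) (C k `|` C' k).
have VE : V = \bigcap_(k in [set: 'I_m]) (C k `|` C' k).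
  by rewrite /V -bigcap_seq; apply/seteqP; split => x h k _;
    apply: h => //=; exact: mem_index_enum.
exists (K0 `&` V), C, C'; split.
- apply: compact_closedI => //; rewrite VE; apply: closed_bigI => k _.
  exact: closedU.
- apply: measurableI => //; apply: bigsetI_measurable => k _.
  exact: measurableU.
- apply: (@le_trans _ _ (P ((setT `\` K0) `|` \big[setU/set0]_(k < m)
      ((A k `\` C k) `|` (B k `\` C' k) `|` Z k)))).
    apply: le_measure; [apply/mem_set|apply/mem_set|].
    + apply: (@measurableC _ (borel T)); apply: measurableI => //.
      by apply: bigsetI_measurable => k _; exact: measurableU.
    + apply: measurableU; first exact: measurableD.
      apply: bigsetU_measurable => k _; apply: measurableU => //.
      by apply: measurableU; exact: measurableD.
    + rewrite -bigcup_seq VE => x nx.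
      case: (pselect (K0 x)) => [K0x|]; last by left.
      right; apply: contrapT => nb; apply: nx; split => // k _.
      apply: contrapT => /not_orP[nC nC']; apply: nb; exists k => /=.
        by rewrite mem_index_enum.
      case: (pselect (Z k x)) => [|nZ]; first by right.
      left; case: (pselect (A k x)) => [|nA]; first by left.
      by right; split => // -[].
  apply: le_trans (measureU2 _ _ _) _; first exact: measurableD.
    apply: bigsetU_measurable => k _; apply: measurableU => //.
    by apply: measurableU; exact: measurableD.
  have -> : eta%:E = (eta' %:E + \sum_(k < m) (eta'%:E + eta'%:E))%E.
    rewrite -EFinD sumEFin -EFinD sumr_const card_ord; congr EFin.
    rewrite -mulr2n -mulrnA mul2n -mulrS /eta' -[RHS]mulr_natr divfK ?pnatr_eq0//.
  apply: leeD => //.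
  apply: le_trans (measure_bigsetU_le _ _ _) _.
    by move=> k; apply: measurableU => //; apply: measurableU; exact: measurableD.
  apply: lee_sum => k _.
  apply: le_trans (measureU2 _ _ _) _ => //.
    by apply: measurableU; exact: measurableD.
  rewrite [X in (_ + X)%E](_ : _ = 0%E) ?adde0; last exact: Z0.
  apply: le_trans (measureU2 _ _ _) _; [exact: measurableD|exact: measurableD|].
  by apply: leeD; [have [] := hC k|have [] := hC' k].
- by move=> k; split.
- rewrite VE => k x [_ /(_ k Logic.I) CC].
  have [_ CA _ _] := hC k; have [_ CB _ _] := hC' k.
  split.
  + split => [/CA//|Ax]; case: CC => // /CB h; exfalso; apply: h; by left.
  + split => [/CB h Ax|nA]; first by apply: h; left.
    by case: CC => // /CA.
  + move=> Zx; case: CC => [/CA//|/CB h]; exfalso; apply: h; by right.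
Qed.

Lemma closed_pattern (C C' : set T) (Q : {set 'I_n} -> Prop) :
  closed C -> closed C' ->
  closed ([set f | exists2 S, Q S & forall i, if i \in S then C (f i) else C' (f
    i)] : set TF).
Proof.
move=> cC cC'.
rewrite (_ : mkset _ = \bigcup_(S in [set S | Q S])
  \bigcap_(i in [set: 'I_n]) [set f : TF | if i \in S then C (f i) else C' (f i)]).
  apply: closed_bigcup => [|S _]; first exact: finite_finset.
  apply: closed_bigI => i _; case: (i \in S); exact: closed_coord.
by apply/seteqP; split => f [S QS h]; exists S => // i; [move=> _|]; apply: h.
Qed.

End compactness.

Lemma outer_measure_cover d (T : measurableType d) (R : realType)
    (Q : probability T R) (E : set T) (r : \bar R) : (Q^* E < r)%E ->
  exists G, [/\ measurable G, E `<=` G & (Q G < r)%E].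
Proof.
move=> /ereal_inf_lt[_ [A [mA EA] <-] lt].
exists (\bigcup_i A i); split => //; first exact: bigcupT_measurable.
apply: le_lt_trans lt; apply: measure_sigma_subadditive => //.
exact: bigcupT_measurable.
Qed.

(** * Separation in type spaces *)

Section types.
Context L (U : structure L) (p : nat) (D : fragment U p).

(** Were neither [psi] nor its negation in [P], the restriction of [P] to the
    fragment [{psi, psi'}] would be empty, hence properly contained in the type
    of any point over this fragment. *)
Lemma clopen_of_setC psi : fragment_set D psi ->
  exists2 psi', fragment_set D psi' & clopen_of D psi' = ~` clopen_of D psi.
Proof.
move=> Dpsi; have [psi' Dpsi' psi'E] := fragment_neg Dpsi.
exists psi' => //; apply/seteqP; split => -[P tP]; rewrite /clopen_of /in_type /=.
  move=> Ppsi' Ppsi; have [_ Psat _] := tP.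
  have [||a ha] := Psat [set psi; psi']; first exact: finite_set2.
    by move=> _ [] ->.
  by have /psi'E := ha psi' (or_intror erefl); apply; apply: ha; left.
move=> nPpsi; apply: contrapT => nPpsi'.
have D0neg chi : [set psi; psi'] chi ->
    exists2 chi', [set psi; psi'] chi' & forall a, psat chi' a <-> ~ psat chi a.
  move=> [->|->]; first by exists psi' => //; right.
  exists psi; first by left.
  by move=> a; split => [h /psi'E//|h]; apply: contrapT => h'; apply: h; apply/psi'E.
pose D0 := Fragment D0neg.
have D0D : D0 `<=` D by move=> _ [] ->.
have [_ _ Pmax] := is_type_restrict D0D tP.
have [c] := carrier_inhabited U; pose a : 'I_p -> U := fun=> c.
have [QD Qsat _] := is_type_tp D0 a.
have : tp D0 a = sval (exist _ _ tP) `&` D0.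
  by apply: Pmax => // chi [Pchi [] e]; rewrite e in Pchi.
move=> /seteqP[sub _].
have [h|h] := pselect (psat psi a).
  by have [] := sub psi (conj (or_introl erefl) h).
have h' : psat psi' a by apply/psi'E.
by have [] := sub psi' (conj (or_intror erefl) h').
Qed.

Lemma closed_clopen_of psi : fragment_set D psi -> closed (clopen_of D psi).
Proof.
move=> /clopen_of_setC[psi' Dpsi' e].
by rewrite -[clopen_of D psi]setCK -e; exact/open_closedC/open_clopen_of.
Qed.

Lemma hausdorff_tspace : hausdorff_space (tspace D).
Proof.
rewrite open_hausdorff => x y xy.
suff [psi [Dpsi px npy]] : exists psi, [/\ fragment_set D psi, sval x psi & ~ sval
  y psi].
  exists (clopen_of D psi, ~` clopen_of D psi); first by split; exact/mem_set.
  split; [exact: open_clopen_of|exact/closed_openC/closed_clopen_of|].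
  by rewrite /= setICr.
apply: contrapT => h; move/eqP : xy; apply.
have sub : sval x `<=` sval y.
  move=> psi px; apply: contrapT => npy; apply: h; exists psi; split => //.
  by have [xD _ _] := svalP x; exact: xD.
have [_ _ xmax] := svalP x; have [yD ysat _] := svalP y.
have := xmax _ sub yD ysat.
case: x y {h sub xmax yD ysat} => [P tP] [P' tP'] /= e.
by move: tP'; rewrite e => tP'; congr exist; exact: Prop_irrelevance.
Qed.

End types.

(** * Averages, completions and the conclusion *)

Lemma eq_Av (R : realType) (T T' : Type) n (t : n.-tuple T) (t' : n.-tuple T')
    (Y : set T) (Y' : set T') :
  (forall i, Y (tnth t i) <-> Y' (tnth t' i)) -> Av R t Y = Av R t' Y'.
Proof.
move=> YY'; rewrite /Av; congr (_%:R / _); apply: eq_card => i; rewrite !inE.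
exact: asbool_equiv_eq.
Qed.

Lemma mu_ext_between d (T : measurableType d) (R : realType) (Q : probability T R)
    (A N Y : set T) :
  measurable A -> measurable N -> Q N = 0%E -> A `<=` Y -> Y `<=` A `|` N ->
  Q^* Y = Q A.
Proof.
move=> mA mN N0 AY YAN; apply/eqP; rewrite eq_le; apply/andP; split.
  apply: le_trans (le_mu_ext _ YAN) _.
  rewrite measurable_mu_extE; last exact: measurableU.
  apply: le_trans (measureU2 _ mA mN) _.
  by rewrite [X in (_ + X)%E](_ : _ = 0%E) ?adde0.
by rewrite -[leLHS]measurable_mu_extE//; exact: le_mu_ext.
Qed.

Lemma one_sub_expn_ge (R : realType) (x : R) n : 0 <= x <= 1 ->
  1 - n%:R * x <= (1 - x) ^+ n.
Proof.
move=> /andP[x0 x1]; elim: n => [|n IH]; first by rewrite mul0r subr0 expr0.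
rewrite exprS; apply: (@le_trans _ _ ((1 - x) * (1 - n%:R * x))).
  rewrite -natr1; have : 0 <= n%:R * x * x by rewrite !mulr_ge0.
  lra.
by rewrite ler_wpM2l// subr_ge0.
Qed.

Theorem theorem4p1 (R : realType) (L : language) (T : theory L)
    (kappa : Type) (U : structure L) (M : set U) (p q : nat)
    (phi : formula L (p + q))
    (mu : probability (borel (stype p [set: U])) R) :
  complete_theory T -> monster_model T kappa U ->
  elementary_submodel M -> small kappa M ->
  regular_measure mu ->
  let MU := fml_over_sub p (subsetT M) in
  let muM := measure_restrict MU mu in
  dependent muM ->
  forall (m : nat) (X : 'I_m -> set (stype p M)),
    (forall k, completed_algebra_gen muM (X k)) ->
  forall eps : R, 0 < eps ->
  exists (n : nat) (E : set (n.-tuple (borel (stype p [set: U])))),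
    [/\ (0 < n)%N, ((1 - eps)%:E <= (power_prob mu n)^* E)%E &
      forall b : 'I_q -> U, (forall j, M (b j)) ->
      forall (k : 'I_m) t, E t ->
        let Y := clopen_of (fml_over p M) (PFml phi b) `&` X k in
        `| fine (muM^* Y) - Av R (map_tuple (trestrict MU) t) Y | <= eps].
Proof.
move=> _ _ _ _ reg MU muM dep m X cX eps eps0.
have hT : hausdorff_space (stype p [set: U]) by exact: hausdorff_tspace.
(* [AN.1] is a measurable core of [X k], and the null set [AN.2] covers the rest, which [F] will
   have to avoid. *)
have hX k : exists AN : set (borel (stype p M)) * set (borel (stype p M)),
    [/\ measurable AN.1, measurable AN.2, muM AN.2 = 0%E,
      AN.1 `<=` X k & X k `<=` AN.1 `|` AN.2].
  have [A mA [N [N' [mN' N'0 NN']] <-]] := cX k.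
  exists (A, N'); split => //=.
  by move=> x [Ax|/NN' N'x]; [left|right].
have [AN hAN] := choice hX.
pose XU k : set (borel (stype p [set: U])) := brestrict MU @^-1` (AN k).1.
pose ZU k : set (borel (stype p [set: U])) := brestrict MU @^-1` (AN k).2.
have mpre (A : set (borel (stype p M))) : measurable A ->
    measurable (brestrict MU @^-1` A : set (borel (stype p [set: U]))).
  by move=> mA; rewrite -[X in measurable X]setTI; exact: measurable_brestrict.
have mXU k : measurable (XU k) by apply: mpre; have [] := hAN k.
have mZU k : measurable (ZU k) by apply: mpre; have [] := hAN k.
have ZU0 k : mu (ZU k) = 0%E by have [] := hAN k.
pose DM (b : 'I_q -> U) : set (borel (stype p M)) := clopen_of (fml_over p M) (PFml
  phi b).
pose DU (b : 'I_q -> U) : set (borel (stype p [set: U])) :=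
  clopen_of (fml_over p [set: U]) (PFml phi b).
have DMU b x : (forall j, M (b j)) -> DM b (trestrict MU x) <-> DU b x.
  move=> Mb; rewrite /DM /DU /clopen_of /in_type /=.
  by split => [[]|].
(* The [m] deviation events cost at most [m * e1 <= eps / 2]; [e1 <= 1] is required by
   [uniform_law], and [e1 <= eps] turns a violation into a deviation. The denominator is nonzero
   even for [m = 0]. *)
pose e1 : R := Num.min 1 (eps / (m.*2.+1)%:R).
have e10 : 0 < e1 by rewrite lt_min ltr01 divr_gt0.
have e11 : e1 <= 1 by rewrite ge_min lexx.
have e1eps : m%:R * e1 <= eps / 2.
  apply: (@le_trans _ _ (m%:R * (eps / (m.*2.+1)%:R))).
    by rewrite ler_wpM2l// ge_min lexx orbT.
  have mE : (m.*2.+1)%:R = m%:R * 2 + 1 :> R by rewrite -natr1 -muln2 natrM.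
  rewrite mulrA ler_pdivrMr// mE.
  by have : 0 <= m%:R :> R by []; move: (m%:R) => y; nra.
have e1_eps : e1 <= eps.
  apply: (@le_trans _ _ (eps / (m.*2.+1)%:R)); first by rewrite ge_min lexx orbT.
  by rewrite ler_pdivrMr// ler_peMr ?ler1n// ltW.
have [n0 hn0] := choice (fun k => uniform_law phi dep (mXU k) e10 e11).
pose n := (\sum_k n0 k).+1.
have n0n k : (n0 k <= n)%N by rewrite /n (bigD1 k)//= -addSn ltnW// ltnS leq_addr.
pose Mtuple := {b : 'I_q -> U | forall j, M (b j)}.
pose J : choiceType := {classic (Mtuple * 'I_m)}.
pose Y (j : J) := clopen_of (fml_over p M) (PFml phi (sval j.1)) `&` X j.2.
pose good (j : J) : set (n.-tuple (borel (stype p [set: U]))) :=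
  [set t | `| fine (muM^* (Y j)) - Av R (map_tuple (trestrict MU) t) (Y j) | <= eps].
(* The largest set with the required property, so only its outer measure remains to be bounded. *)
exists n, [set t | forall j, good j t]; split => //; last first.
  by move=> b Mb k t Et; exact: (Et (exist _ b Mb, k)).
rewrite leNgt; apply/negP => /outer_measure_cover[G [mG EG PG]].
(* By Bernoulli's inequality [F^n] then has measure at least 1 - n eta >= 1 - eps/2. *)
pose eta := Num.min 1 (eps / (2 * n%:R)).
have eta0 : 0 < eta by rewrite lt_min ltr01 divr_gt0// mulr_gt0.
have eta1 : eta <= 1 by rewrite ge_min lexx.
have [F [C [C' [cF mF PF cC hF]]]] :=
  compact_decision hT reg mXU mZU ZU0 eta0.
pose Fn := [set t : n.-tuple (borel (stype p [set: U])) | forall i, F (tnth t i)].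
have mFn : measurable Fn by apply: (@measurable_tuple_box _ (borel (stype p [set:
  U])) n (fun=> F)).
have PFn : ((1 - eps / 2)%:E <= power_prob mu n Fn)%E.
  rewrite (@power_prob_box _ (borel (stype p [set: U])) _ mu n (fun=> F))//.
  have PFE : mu F = (fine (mu F))%:E by rewrite fineK ?fin_num_measure.
  rewrite (eq_bigr (fun=> (fine (mu F))%:E)); last by move=> i _.
  rewrite prodEFin prodr_const card_ord lee_fin.
  apply: (@le_trans _ _ ((1 - eta) ^+ n)).
    apply: le_trans (one_sub_expn_ge _ _); last by rewrite ltW.
    rewrite lerD2l lerN2; apply: (@le_trans _ _ (n%:R * (eps / (2 * n%:R)))).
      by rewrite ler_wpM2l// ge_min lexx orbT.
    by rewrite invfM [eps * _]mulrA mulrCA divff ?mulr1// pnatr_eq0.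
  apply: lerXn2r; rewrite ?nnegrE ?subr_ge0 ?fine_ge0//.
  move: PF; rewrite probability_setC// PFE -EFinB lee_fin; lra.
(* Bad tuples inside [F^n]; more than eps - eps/2 of the mass is left. *)
pose H := ~` G `&` Fn.
have mH : measurable H by apply: measurableI => //; exact: measurableC.
have PH : ((eps / 2)%:E < power_prob mu n H)%E.
  have : (power_prob mu n Fn <= power_prob mu n G + power_prob mu n H)%E.
    apply: le_trans (measureU2 _ mG mH); apply: le_measure;
      [exact/mem_set|exact/mem_set/measurableU|].
    by move=> t Ft; case: (pselect (G t)) => Gt; [left|right].
  have PGE : power_prob mu n G = (fine (power_prob mu n G))%:E by rewrite fineK
    ?fin_num_measure.
  have PHE : power_prob mu n H = (fine (power_prob mu n H))%:E by rewrite fineK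
    ?fin_num_measure.
  move=> /(le_trans PFn); move: PG; rewrite PGE PHE -EFinD lee_fin !lte_fin.
  by move: (fine _) (fine _) => a b; lra.
pose pat (j : J) (S : {set 'I_n}) : Prop :=
  `|fine (muM^* (Y j)) - #|S|%:R / n%:R| <= eps.
(* The estimate in closed form: a hit pattern [S] of admissible size, where hitting and missing are
   both closed conditions thanks to [C] and [C']. *)
pose g (j : J) := [set f : prod_topology (fun _ : 'I_n => stype p [set: U]) |
  exists2 S, pat j S & forall i, if i \in S
    then (clopen_of (fml_over p [set: U]) (PFml phi (sval j.1)) `&` C j.2) (f i)
    else (~` clopen_of (fml_over p [set: U]) (PFml phi (sval j.1)) `|` C' j.2) (f i)].
have YF (j : J) x : F x -> Y j (trestrict MU x) <-> (DU (sval j.1) `&` XU j.2) x.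
  move=> Fx; have [_ _ ZX] := hF j.2 x Fx; have [_ _ _ AX XA] := hAN j.2.
  split => -[h1 h2]; split.
  - by apply/DMU => //; exact: (svalP j.1).
  - by have [//|] := XA _ h2.
  - by apply/(DMU (sval j.1)) => //; exact: (svalP j.1).
  - exact: AX.
have AvF (j : J) t : Fn t -> Av R (map_tuple (trestrict MU) t) (Y j) =
    Av R t (DU (sval j.1) `&` XU j.2).
  by move=> Ft; apply: eq_Av => i; rewrite tnth_map; exact: YF.
have cg j : closed (g j).
  apply: closed_pattern; have [c c'] := cC j.2.
    by apply: closedI => //; exact: closed_clopen_of.
  by apply: closedU => //; apply/open_closedC/open_clopen_of.
have patE (j : J) x : F x ->
    ((clopen_of (fml_over p [set: U]) (PFml phi (sval j.1)) `&` C j.2) x <->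
       (DU (sval j.1) `&` XU j.2) x) /\
    ((~` clopen_of (fml_over p [set: U]) (PFml phi (sval j.1)) `|` C' j.2) x <->
       ~ (DU (sval j.1) `&` XU j.2) x).
  move=> Fx; have [CE C'E _] := hF j.2 x Fx; split; split.
  - by move=> [? /CE].
  - by move=> [? /CE].
  - by move=> [nD [//]|/C'E nX [_ //]].
  - by move=> /not_andP[nD|/C'E]; [left|right].
have gE (j : J) (f : prod_topology (fun _ : 'I_n => stype p [set: U])) :
    (forall i, F (f i)) -> points (good j) f <-> g j f.
  move=> Ff; have Ft : Fn [tuple f i | i < n] by move=> i; rewrite tnth_mktuple;
    exact: Ff.
  have card_E (S : {set 'I_n}) : (forall i, i \in S <-> (DU (sval j.1) `&` XU j.2)
    (f i)) ->
      Av R [tuple f i | i < n] (DU (sval j.1) `&` XU j.2) = #|S|%:R / n%:R.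
    move=> hS; rewrite /Av; congr (_%:R / _); apply: eq_card => i.
    rewrite inE tnth_mktuple; apply/asboolP/idP; by move/hS.
  rewrite /points /good /= AvF//; split => [h|[S pS hS]].
    exists (finset.finset (fun i => `[< (DU (sval j.1) `&` XU j.2) (f i) >])).
      rewrite /pat -card_E// => i; rewrite inE.
      by split => [/asboolP|?]; last exact/asboolP.
    move=> i; rewrite inE; have [E1 E2] := patE j _ (Ff i).
    by case: asboolP => h'; [apply/E1|apply/E2].
  rewrite (card_E S)// => i; have [E1 E2] := patE j _ (Ff i).
  by have := hS i; case: (i \in S) => [/E1|/E2].
have [D [K [mK KH dK hK]]] := finite_subcover hT reg cF cg gE mH (fun t Ht => Ht.2)
  (fun t Ht h => Ht.1 (EG t h)) PH.
(* A point of [K] yields an element [j0] of the index type, the default value for [nth]. *)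
have [t0 Kt0] : K !=set0.
  apply/set0P; apply: contraTneq dK => ->.
  by rewrite measure0 lte_fin -leNgt divr_ge0// ltW.
have [j0 _ _] := hK _ Kt0.
pose b l : 'I_q -> U := sval (nth j0 D l).1.
have Mb l i : M (b l i) by exact: (svalP (nth j0 D l).1).
pose dev (k : 'I_m) := [set t : n.-tuple (borel (stype p [set: U])) |
  exists2 l, (l < size D)%N &
    e1 < `|Av R t (DU (b l) `&` XU k) - fine (mu (DU (b l) `&` XU k))|].
have mDX c k : measurable (DU c `&` XU k).
  by apply: measurableI => //; exact: measurable_Dphi.
have mdev k : measurable (dev k).
  exact: (@measurable_Av_deviation _ _ _ _ _ (fun l => DU (b l) `&` XU k)
    (fun l => fine (mu (DU (b l) `&` XU k)))).
(* On [F^n] the averages of restricted and of global types agree, and [muM^*] of [Y j] is the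
   measure of its core; so a tuple bad for [j] deviates at the index of [j] in [D]. *)
have Kdev : K `<=` \big[setU/set0]_(k < m) dev k.
  rewrite -bigcup_seq => t Kt; have [j jD ngood] := hK _ Kt.
  exists j.2; first by rewrite /= mem_index_enum.
  exists (index j D); first by rewrite index_mem.
  have bE : b (index j D) = sval j.1 by rewrite /b nth_index.
  have Ft : Fn t by have [] := KH _ Kt.
  rewrite bE -AvF// distrC.
  have [mA mN N0 AX XA] := hAN j.2.
  have mDM : measurable (DM (sval j.1)) by apply: measurable_clopen; exact: (svalP j.1).
  rewrite (_ : mu (DU _ `&` XU j.2) = muM^* (Y j)).
    by apply: (le_lt_trans e1_eps); rewrite ltNge; apply/negP.
  rewrite (@mu_ext_between _ _ _ muM (DM (sval j.1) `&` (AN j.2).1) (AN j.2).2)//.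
  - change (mu (DU (sval j.1) `&` XU j.2) = mu (brestrict MU @^-1` (DM (sval j.1)
      `&` (AN j.2).1))).
    congr (mu _); apply/seteqP; split => x [h1 h2]; split => //.
      by apply/(DMU (sval j.1)) => //; exact: (svalP j.1).
    by apply/(DMU (sval j.1)) => //; exact: (svalP j.1).
  - exact: measurableI.
  - by move=> x [h1 h2]; split => //; exact: AX.
  - by move=> x [h1 /XA[h2|h2]]; [left; split|right].
have : (power_prob mu n K <= (eps / 2)%:E)%E.
  apply: (@le_trans _ _ (power_prob mu n (\big[setU/set0]_(k < m) dev k))).
    apply: le_measure; [exact/mem_set| |exact: Kdev].
    by apply/mem_set; apply: bigsetU_measurable => k _; exact: mdev.
  apply: le_trans (measure_bigsetU_le _ _ mdev) _.
  apply: (@le_trans _ _ (\sum_(k < m) e1%:E)%E).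
    by apply: lee_sum => k _; exact: (hn0 k n (n0n k) (size D) b Mb).
  by rewrite sumEFin lee_fin sumr_const card_ord -[leLHS]mulr_natl.
by rewrite leNgt dK.
Qed.
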